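(* Let $n$ be a positive integer, $1\le s\le\lfloor n/2\rfloor$, and let $G=C_n(1,\dots,s)$ be the circulant graph. The cover ideal $J(G)$ is Freiman if and only if $s>\frac{n-4}{2}$ or $G\in\{C_5,C_7\}$.
   Context: The circulant graph $C_n(1,2,\dots,s)$ is the simple graph with vertex set $\{x_1,\dots,x_n\}$ and edges $\{x_i,x_{i+j}\}$ for $j\in\{\pm1,\dots,\pm s\}$, indices taken modulo $n$; $C_n=C_n(1)$ is the $n$-cycle. For a graph $G$ with vertices $x_1,\dots,x_n$ (identified with the variables of $R=k[x_1,\dots,x_n]$, $k$ a field) and edge set $E$, the cover ideal is $J(G)=\bigcap_{\{x_i,x_j\}\in E}(x_i,x_j)\subseteq R$. A monomial ideal $I\subseteq R$ with minimal monomial generators $f_1,\dots,f_t$, $f_j=\prod_{i=1}^n x_i^{c_{ij}}$, is quasi-equigenerated if there is $\alpha=(a_1,\dots,a_n)$ with all $a_i$ positive integers such that $\sum_{i=1}^n a_i c_{ij}$ is the same for all $j$. The fiber cone is $F(I)=\bigoplus_{i\ge0}I^i/\mathfrak m I^i$ with $\mathfrak m=(x_1,\dots,x_n)$; the analytic spread $l(I)$ is the Krull dimension of $F(I)$; $\mu(\cdot)$ is the minimal number of generators. A monomial ideal $I$ is Freiman if it is quasi-equigenerated and $\mu(I^2)=l(I)\mu(I)-\binom{l(I)}{2}$ (in particular, an ideal that is not quasi-equigenerated is not Freiman). *)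

(* Defs.v *)
From HB Require Import structures.
From mathcomp Require Import all_boot all_order all_algebra.
From mathcomp Require Import ring_quotient.
From mathcomp Require Import boolp.
From mathcomp Require Import mpoly.

Set Implicit Arguments.
Unset Strict Implicit.
Unset Printing Implicit Defensive.

Import Order.TTheory GRing.Theory Num.Theory.
Local Open Scope ring_scope.

Section Ideals.
Variable A : comNzRingType.
Implicit Types (S I J : {pred A}).

Definition ideal_gen S : {pred A} := fun x =>
  `[< exists t : seq (A * A),
        (forall p, p \in t -> p.2 \in S) /\ x = \sum_(p <- t) p.1 * p.2 >].

Definition ideal_mul I J : {pred A} :=
  ideal_gen (fun x => `[< exists a b, [/\ a \in I, b \in J & x = a * b] >]).

(* I^0 is the whole ring, even when I is the zero ideal. *)
Definition ideal_pow I (i : nat) : {pred A} := iter i (ideal_mul I) predT.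

(* t = mu(I).  No constraint is put on the generators; for a homogeneous (in
   particular a monomial) ideal of a polynomial ring over a field this is the
   dimension of I / m I. *)
Definition is_mu I (t : nat) : Prop :=
  (exists2 s : seq A, size s = t & I =i ideal_gen (mem s)) /\
  (forall s : seq A, I =i ideal_gen (mem s) -> (t <= size s)%N).

(* idealr_closed includes properness: 1 \notin P. *)
Definition prime_ideal (P : {pred A}) : Prop :=
  idealr_closed P /\ prime_idealr_closed P.

(* P 0 < P 1 < ... < P d; the values of P above d are irrelevant. *)
Definition prime_chain (d : nat) (P : nat -> {pred A}) : Prop :=
  (forall i, (i <= d)%N -> prime_ideal (P i)) /\
  (forall i, (i < d)%N ->
     {subset P i <= P i.+1} /\ ~ {subset P i.+1 <= P i}).

Definition is_krull_dim (d : nat) : Prop :=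
  (exists P, prime_chain d P) /\
  (forall e P, prime_chain e P -> (e <= d)%N).

Lemma ideal_genP S x :
  reflect (exists t : seq (A * A),
        (forall p, p \in t -> p.2 \in S) /\ x = \sum_(p <- t) p.1 * p.2)
    (x \in ideal_gen S).
Proof. exact: asboolP. Qed.

Lemma mem_ideal_gen S x : x \in S -> x \in ideal_gen S.
Proof.
move=> Sx; apply/ideal_genP; exists [:: (1, x)].
split; first by move=> p; rewrite inE => /eqP->.
by rewrite big_seq1 mul1r.
Qed.

Lemma ideal_gen0 S : 0 \in ideal_gen S.
Proof. by apply/ideal_genP; exists [::]; rewrite big_nil. Qed.

Lemma ideal_genD S x y :
  x \in ideal_gen S -> y \in ideal_gen S -> x + y \in ideal_gen S.
Proof.
move=> /ideal_genP[t [tS ->]] /ideal_genP[u [uS ->]].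
apply/ideal_genP; exists (t ++ u); rewrite big_cat; split=> // p.
by rewrite mem_cat => /orP[/tS|/uS].
Qed.

Lemma ideal_genM S a x : x \in ideal_gen S -> a * x \in ideal_gen S.
Proof.
move=> /ideal_genP[t [tS ->]].
apply/ideal_genP; exists [seq (a * p.1, p.2) | p <- t]; split.
  by move=> _ /mapP[q /tS qS ->].
by rewrite big_map mulr_sumr; apply: eq_bigr => p _; rewrite mulrA.
Qed.

Lemma ideal_gen_sum S (T : Type) (r : seq T) (Q : pred T) (F : T -> A) :
  (forall i, Q i -> F i \in ideal_gen S) -> \sum_(i <- r | Q i) F i \in ideal_gen S.
Proof.
move=> FS; elim/big_ind: _ => //; [exact: ideal_gen0 | exact: ideal_genD].
Qed.

Lemma ideal_gen_min S (P : {pred A}) :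
    0 \in P -> {in P &, forall x y, x + y \in P} ->
    (forall a, {in P, forall x, a * x \in P}) ->
  {subset S <= P} -> {subset ideal_gen S <= P}.
Proof.
move=> P0 PD PM SP x /ideal_genP[t [tS ->]].
rewrite big_seq; elim/big_ind: _ => // p /tS/SP; exact: PM.
Qed.

Lemma ideal_mulP I J a b : a \in I -> b \in J -> a * b \in ideal_mul I J.
Proof. by move=> Ia Jb; apply/mem_ideal_gen/asboolP; exists a, b. Qed.

Lemma ideal_pow0 I i : 0 \in ideal_pow I i.
Proof. by case: i => // i; exact: ideal_gen0. Qed.

Lemma ideal_powD I i x y :
  x \in ideal_pow I i -> y \in ideal_pow I i -> x + y \in ideal_pow I i.
Proof. by case: i => // i; exact: ideal_genD. Qed.

Lemma ideal_powM I i a x : x \in ideal_pow I i -> a * x \in ideal_pow I i.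
Proof. by case: i => // i; exact: ideal_genM. Qed.

Lemma ideal_mul_pow I J i j x y :
    (forall z, z \in ideal_pow I i -> z * y \in ideal_pow I j) ->
  x \in ideal_mul J (ideal_pow I i) -> x * y \in ideal_mul J (ideal_pow I j).
Proof.
move=> zy xJ; suff: x \in [pred x | x * y \in ideal_mul J (ideal_pow I j)] by [].
move: x xJ; apply: ideal_gen_min.
- by rewrite inE mul0r ideal_gen0.
- by move=> u v; rewrite !inE mulrDl; exact: ideal_genD.
- by move=> a u; rewrite !inE -mulrA; exact: ideal_genM.
move=> _ /asboolP[a [b [Ja bI ->]]]; rewrite inE -mulrA.
exact/ideal_mulP/zy.
Qed.

Lemma ideal_pow_mul I i j x y :
  x \in ideal_pow I i -> y \in ideal_pow I j -> x * y \in ideal_pow I (i + j).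
Proof.
move=> xI yI; elim: i x xI => [|i IH] x xI; first exact: ideal_powM.
exact: ideal_mul_pow xI.
Qed.

(* The Rees algebra, the sum of the I^i t^i inside A[t]. *)
Definition rees I : {pred {poly A}} :=
  fun p => `[< forall i, p`_i \in ideal_pow I i >].

Lemma rees_subring I : subring_closed (rees I).
Proof.
split.
- apply/asboolP=> i; rewrite coef1; case: i => [|i] //; exact: (ideal_pow0 I i.+1).
- move=> p q /asboolP pI /asboolP qI; apply/asboolP=> i.
  by rewrite coefB -mulN1r; apply: ideal_powD => //; exact: ideal_powM.
move=> p q /asboolP pI /asboolP qI; apply/asboolP=> i; rewrite coefM.
elim/big_ind: _ => [|u v|j _]; [exact: ideal_pow0 | exact: ideal_powD | ].
have := ideal_pow_mul (pI j) (qI (i - j)%N).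
by rewrite subnKC // -ltnS.
Qed.

HB.instance Definition _ I :=
  GRing.isSubringClosed.Build {poly A} (rees I) (rees_subring I).

Record rees_algebra I := ReesAlgebra {
  rees_poly : {poly A};
  rees_polyP : rees_poly \in rees I }.

HB.instance Definition _ I := [isSub for @rees_poly I].
HB.instance Definition _ I := [Choice of rees_algebra I by <:].
HB.instance Definition _ I := [SubChoice_isSubComNzRing of rees_algebra I by <:].

End Ideals.

Section MonomialIdeals.
Variables (k : fieldType) (n : nat).
Implicit Types I : {pred {mpoly k[n]}}.

Definition maxI : {pred {mpoly k[n]}} :=
  ideal_gen (fun f => [exists i : 'I_n, f == 'X_i]).

Lemma maxI_coef0 (f : {mpoly k[n]}) : f \in maxI -> f@_0%MM = 0.
Proof.
move=> fm; apply/eqP; suff: f \in [pred f : {mpoly k[n]} | f@_0%MM == 0] by [].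
move: f fm; apply: ideal_gen_min.
- by rewrite inE mcoeff0.
- by move=> u v; rewrite !inE mcoeffD => /eqP-> /eqP->; rewrite addr0.
- by move=> a u; rewrite !inE (rmorphM (mcoeff 0%MM)) => /eqP /= ->; rewrite mulr0.
move=> _ /existsP[i /eqP->]; rewrite inE mcoeffX.
suff /negPf-> : (U_(i) != 0)%MM by rewrite eqxx.
by apply/eqP=> /mnmP/(_ i); rewrite mnm1E mnm0E eqxx.
Qed.

(* The kernel of the projection of the Rees algebra, the sum of the I^i t^i,
   onto the sum of the I^i / m I^i. *)
Definition fiber_ideal I : {pred rees_algebra I} :=
  fun p => `[< forall i, (rees_poly p)`_i \in ideal_mul maxI (ideal_pow I i) >].

Lemma fiber_ideal_closed I : idealr_closed (@fiber_ideal I).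
Proof.
split.
- by apply/asboolP=> i; rewrite coef0 ideal_gen0.
- apply/negP=> /asboolP /(_ 0%N); rewrite coef1 /= => m1.
  suff /maxI_coef0/eqP : (1 : {mpoly k[n]}) \in maxI.
    by rewrite mcoeff1 eqxx oner_eq0.
  move: m1; apply: ideal_gen_min.
  + exact: ideal_gen0.
  + by move=> u v; exact: ideal_genD.
  + by move=> a u; exact: ideal_genM.
  by move=> _ /asboolP[a [b [am _ ->]]]; rewrite mulrC; exact: ideal_genM.
move=> a p q /asboolP pI /asboolP qI; apply/asboolP=> i.
rewrite coefD; apply: ideal_genD => //; rewrite coefMr.
apply: ideal_gen_sum => j _.
rewrite mulrC; apply: ideal_mul_pow (pI j) => z zI.
have /asboolP aI := rees_polyP a.
by have := ideal_pow_mul zI (aI (i - j)%N); rewrite subnKC // -ltnS.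
Qed.

HB.instance Definition _ I :=
  isIdealr.Build (rees_algebra I) (@fiber_ideal I) (@fiber_ideal_closed I).

Definition fiber_cone I : comNzRingType := {ideal_quot @fiber_ideal I}.

Definition is_analytic_spread I (l : nat) : Prop :=
  is_krull_dim (fiber_cone I) l.

Definition monomial_ideal I : Prop :=
  exists S : {pred 'X_{1..n}},
    I =i ideal_gen (fun f => `[< exists2 m, m \in S & f = 'X_[m] >]).

Definition min_mon_gen I (m : 'X_{1..n}) : Prop :=
  'X_[m] \in I /\ forall m', 'X_[m'] \in I -> (m' <= m)%MM -> m' = m.

Definition quasi_equigenerated I : Prop :=
  exists a : 'I_n -> nat, (forall i, (0 < a i)%N) /\
  exists d : nat, forall c, min_mon_gen I c -> (\sum_(i < n) a i * c i)%N = d.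

Definition Freiman I : Prop :=
  [/\ monomial_ideal I, quasi_equigenerated I
    & exists l mu1 mu2 : nat,
        [/\ is_analytic_spread I l, is_mu I mu1, is_mu (ideal_pow I 2) mu2
          & mu2%:Z = l%:Z * mu1%:Z - 'C(l, 2)%:Z]].

End MonomialIdeals.

Record sgraph (V : finType) := SGraph {
  adj :> rel V;
  adj_sym : ssrbool.symmetric adj;
  adj_irr : irreflexive adj }.

Definition isomorphic (V W : finType) (G : sgraph V) (H : sgraph W) : Prop :=
  exists f : V -> W, bijective f /\ forall x y, H (f x) (f y) = G x y.

(* The vertices x_1, ..., x_n are numbered 0, ..., n-1. *)
Definition circulant_adj (n s : nat) : rel 'I_n := fun x y =>
  (x != y) && [exists d : 'I_s, (y == x + d.+1 %[mod n])%N
                             || (x == y + d.+1 %[mod n])%N].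

Lemma circulant_sym n s : ssrbool.symmetric (@circulant_adj n s).
Proof.
move=> x y; rewrite /circulant_adj eq_sym; congr (_ && _).
by apply: eq_existsb => d; rewrite orbC.
Qed.

Lemma circulant_irr n s : irreflexive (@circulant_adj n s).
Proof. by move=> x; rewrite /circulant_adj eqxx. Qed.

Definition circulant (n s : nat) : sgraph 'I_n :=
  SGraph (@circulant_sym n s) (@circulant_irr n s).

Definition cycle_graph (n : nat) : sgraph 'I_n := circulant n 1.

Definition cover_ideal (k : fieldType) (n : nat) (G : sgraph 'I_n) :
    {pred {mpoly k[n]}} :=
  fun f => `[< forall i j, G i j -> f \in ideal_gen (pred2 'X_i 'X_j) >].
Arguments cover_ideal k {n} G.

(* Main.v *)
(* Generators of J(G) are the complements of the maximal independent sets of G,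
   and with s <= n/2 every such set of C_n(1..s) splits the circle, when
   n >= 2s + 2, into gaps between s + 1 and 2s + 1.

   If n <= 2s + 3, or n = 7 and s = 1, these sets all have the same size and
   a nonnegative combination of their indicators determines its coefficients;
   then the fiber cone is a polynomial ring in mu variables, so l = mu and
   mu(I^2) = C(mu + 1, 2), which is Freiman's equality.

   If 3s + 3 <= n and n <> 4s + 3, two sets differing by replacing two
   vertices by one yield, summing a weight over all rotations, that its total is
   zero: J(G) is not quasi-equigenerated.

   Otherwise all maximal independent sets have r = 2 or r = 3 elements.  Since
   l <= n, it suffices to bound mu(I^2) from below.  A sum of two indicators is
   a cyclic multiset of size 2r; it comes from at most 2r unrolled sequences
   c_1 <= ... <= c_2r <= c_1 + n, and those whose odd and even entries form
   maximal independent sets are counted directly.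

   The bound on the Krull dimension of the fiber cone needs no dimension theory:
   picking elements along a chain of e primes gives e algebraically independent
   elements, while the degree-T part of the fiber cone only has polynomially many
   monomials. *)
Require Import Defs.
From mathcomp Require Import all_boot all_order all_algebra.
From mathcomp Require Import mpoly ring_quotient boolp zify.

Set Implicit Arguments.
Unset Strict Implicit.
Unset Printing Implicit Defensive.

Import Order.TTheory GRing.Theory Num.Theory.
Local Open Scope ring_scope.

(** * Fiber cones of monomial ideals *)

Section MonomialIdeals.
Variables (k : fieldType) (n : nat).
Implicit Types (f : {mpoly k[n]}) (m g : 'X_{1..n}) (S : 'X_{1..n} -> Prop).

(** When [S] is upward closed this is the ideal spanned by the monomials in [S]; membership becomes
    a condition on each exponent separately. *)
Definition monideal S : {pred {mpoly k[n]}} :=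
  fun f => `[< forall m, m \in msupp f -> S m >].

Lemma monidealP S f :
  reflect (forall m, m \in msupp f -> S m) (f \in monideal S).
Proof. exact: asboolP. Qed.

Lemma monidealX S m : ('X_[m] \in monideal S) <-> S m.
Proof.
split=> [/monidealP|Sm]; first by apply; exact/mem_msuppXP.
by apply/monidealP => m' /mem_msuppXP <-.
Qed.

Lemma monideal_sub_gen S (T : {pred {mpoly k[n]}}) :
    (forall m, S m -> 'X_[m] \in ideal_gen T) ->
  {subset monideal S <= ideal_gen T}.
Proof.
move=> ST f /monidealP Sf; rewrite [f]mpolyE big_seq.
apply: ideal_gen_sum => m mf; rewrite -mul_mpolyC.
exact/ideal_genM/ST/Sf.
Qed.

Lemma gen_sub_monideal S (T : {pred {mpoly k[n]}}) :
    (forall m m', S m -> S (m' + m)%MM) -> {subset T <= monideal S} ->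
  {subset ideal_gen T <= monideal S}.
Proof.
move=> Sup; apply: ideal_gen_min.
- by apply/monidealP => m; rewrite msupp0.
- move=> u v /monidealP Su /monidealP Sv; apply/monidealP => m.
  by move/msuppD_le; rewrite mem_cat => /orP[/Su|/Sv].
move=> a u /monidealP Su; apply/monidealP => m /msuppM_le /allpairsP.
by case=> -[m1 m2] /= [_ /Su Sm2 ->]; exact: Sup.
Qed.

Lemma monideal_homogX S d f : (forall m, S m -> (d <= mdeg m)%N) ->
  f \in monideal S -> forall m, (mdeg m < d)%N -> f@_m = 0.
Proof.
move=> Sd /monidealP Sf m md; apply: memN_msupp_eq0; apply/negP => /Sf/Sd.
by rewrite leqNgt md.
Qed.

Variable G : seq 'X_{1..n}.

Definition above m : Prop := exists2 g, g \in G & (g <= m)%MM.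

Fixpoint gpow i m : Prop :=
  if i is i'.+1 then exists g m', [/\ g \in G, gpow i' m' & m = (g + m')%MM]
  else m = 0%MM.

Lemma gpow1 g : gpow 1 g <-> g \in G.
Proof.
split=> [[g' [m' [g'G -> ->]]]|gG]; first by rewrite addm0.
by exists g, 0%MM; rewrite addm0.
Qed.

Lemma gpow2 m : gpow 2 m <-> exists g h, [/\ g \in G, h \in G & m = (g + h)%MM].
Proof.
split=> [[g [m' [gG /gpow1 m'G ->]]]|[g [h [gG hG ->]]]]; first by exists g, m'.
by exists g, h; split=> //; apply/gpow1.
Qed.

Lemma gpow_mdeg r : (forall g, g \in G -> mdeg g = r) ->
  forall i m, gpow i m -> mdeg m = (i * r)%N.
Proof.
move=> Gr; elim=> [|i IH] m /=; first by move->; rewrite mdeg0.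
by move=> [g [m' [/Gr gr /IH m'r ->]]]; rewrite mdegD gr m'r mulSn.
Qed.

Variable I : {pred {mpoly k[n]}}.
Hypothesis IG : I =i monideal above.

Lemma monideal_pow i :
  ideal_pow I i =i monideal (fun m => exists2 g, gpow i g & (g <= m)%MM).
Proof.
have up j m m' : (exists2 g, gpow j g & (g <= m)%MM) ->
    exists2 g, gpow j g & (g <= m' + m)%MM.
  by move=> [g gj gm]; exists g => //; exact: lepm_trans gm (lem_addl _ _).
elim: i => [|i IH] f /=.
  by apply/esym/monidealP => m _; exists 0%MM => //; apply/mnm_lepP => j; rewrite mnm0E.
apply/idP/idP; move: f.
  apply: gen_sub_monideal => [m m'|x /asboolP[a [b []]]]; first exact: (up i.+1).
  rewrite IG IH => /monidealP aG /monidealP bG ->{x}; apply/monidealP => m.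
  move/msuppM_le/allpairsP => -[[m1 m2] /= [/aG[g gG gm1] /bG[h hi hm2] ->]].
  exists (g + h)%MM; first by exists g, h.
  by apply/mnm_lepP => j; rewrite !mnmDE leq_add ?(mnm_lepP _ _).
apply: monideal_sub_gen => m [x [g [h [gG hi ->{x}]]] gm].
rewrite -(submK gm) mpolyXD; apply/ideal_genM; rewrite mpolyXD.
apply: ideal_mulP; first by rewrite IG; apply/monidealX; exists g; rewrite ?lepm_refl.
by rewrite IH; apply/monidealX; exists h; rewrite ?lepm_refl.
Qed.

(** A factor from [maxI] has no constant term, so it strictly enlarges a product of [i] generators;
    conversely a strict multiple has a variable to spare, which supplies that factor. *)
Lemma monideal_max_pow i : ideal_mul (@maxI k n) (ideal_pow I i) =i
  monideal (fun m => exists g, [/\ gpow i g, (g <= m)%MM & g != m]).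
Proof.
move=> f; apply/idP/idP; move: f.
  apply: gen_sub_monideal => [m m' [g [gi gm neq]]|x /asboolP[a [b []]]].
    exists g; split=> //; first exact: lepm_trans gm (lem_addl _ _).
    apply: contra neq => /eqP E; apply/eqP/mnmP => j.
    by move/mnm_lepP/(_ j): gm; rewrite E mnmDE; lia.
  move/maxI_coef0 => a0; rewrite monideal_pow => /monidealP bG ->{x}.
  apply/monidealP => m /msuppM_le/allpairsP -[[m1 m2] /= [am1 /bG[g gi gm2] ->]].
  exists g; split=> //; first exact: lepm_trans gm2 (lem_addl _ _).
  apply/eqP => E; move: am1; rewrite mcoeff_msupp.
  suff -> : m1 = 0%MM by rewrite a0 eqxx.
  apply/mnmP => j; move/mnm_lepP/(_ j): gm2.
  by rewrite E mnmDE mnm0E; lia.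
apply: monideal_sub_gen => m [g [gi gm neq]].
have [j mj] : exists j, (m - g)%MM j != 0%N.
  apply/existsP; apply: contraNT neq; rewrite negb_exists => /forallP mg0.
  apply/eqP/mnmP => j; move/mnm_lepP/(_ j): gm.
  by have := mg0 j; rewrite negbK mnmBE; lia.
have le1 : (U_(j) <= m - g)%MM by rewrite lep1mP.
rewrite -(submK gm) mpolyXD -(submK le1) mpolyXD -mulrA; apply: ideal_genM.
apply: ideal_mulP; first by apply: mem_ideal_gen; apply/existsP; exists j.
by rewrite monideal_pow; apply/monidealX; exists g; rewrite ?lepm_refl.
Qed.

End MonomialIdeals.

(** * Number of generators of equigenerated monomial ideals *)

Section MinimalNumberOfGenerators.
Variables (k : fieldType) (n : nat).
Implicit Types (a b : {mpoly k[n]}) (L : seq 'X_{1..n}).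

(** Nonconstant terms of [a] raise the degree, so only its constant term contributes in degree
    [d]. *)
Lemma mcoeffM_min_mdeg d a b (m : 'X_{1..n}) :
    (forall m', (mdeg m' < d)%N -> b@_m' = 0) -> mdeg m = d ->
  (a * b)@_m = a@_0%MM * b@_m.
Proof.
move=> b0 md; rewrite mcoeffM.
have lt0 : (mdeg (0%MM : 'X_{1..n}) < (mdeg m).+1)%N by rewrite mdeg0.
have ltm : (mdeg m < (mdeg m).+1)%N by [].
rewrite (bigD1 (BMultinom lt0, BMultinom ltm)) /= ?add0m // big1 ?addr0 //.
move=> [[k1 h1] [k2 h2]] /= /andP[/eqP mE neq].
rewrite b0 ?mulr0 // -md mE mdegD -[X in (X < _)%N]add0n ltn_add2r lt0n mdeg_eq0.
apply: contraNneq neq => k10.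
by rewrite xpair_eqE -!val_eqE /= k10 mE k10 add0m !eqxx.
Qed.

(* Modulo terms of degree > d, a combination of elements of J only involves the
   constant terms of its coefficients, so [size L] is at most the rank of the
   coefficients of any generating family. *)
Lemma mu_equigenerated d L (J : {pred {mpoly k[n]}}) :
    uniq L -> (forall m, m \in L -> mdeg m = d) -> J =i monideal (above L) ->
  is_mu J (size L).
Proof.
move=> uL Ld JL.
have Jd b : b \in J -> forall m, (mdeg m < d)%N -> b@_m = 0.
  rewrite JL; apply: monideal_homogX => m [g gL gm].
  by rewrite -(Ld _ gL) -(submK gm) mdegD leq_addl.
split.
  exists [seq 'X_[m] | m <- L]; first by rewrite size_map.
  move=> f; rewrite JL; apply/idP/idP; move: f.
    apply: monideal_sub_gen => m [g gL gm].
    rewrite -(submK gm) mpolyXD; apply/ideal_genM/mem_ideal_gen.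
    by apply/mapP; exists g.
  apply: gen_sub_monideal => [m m' [g gL gm]|_ /mapP[g gL ->]].
    by exists g => //; exact: lepm_trans gm (lem_addl _ _).
  by apply/monidealX; exists g; rewrite ?lepm_refl.
move=> s sJ.
pose V : 'M[k]_(size s, size L) := \matrix_(i, j) (s`_i)@_(nth 0%MM L j).
suff : (1%:M <= V)%MS by move/mxrankS; rewrite mxrank1 => /leq_trans-> //; exact: rank_leq_row.
apply/row_subP => i.
have iL : nth 0%MM L i \in L by exact: mem_nth.
have : 'X_[nth 0%MM L i] \in ideal_gen (mem s).
  by rewrite -sJ JL; apply/monidealX; exists (nth 0%MM L i); rewrite ?lepm_refl.
case/ideal_genP => t [ts E].
have -> : row i 1%:M = \sum_(p <- t) p.1@_0%MM *:
    \row_j (p.2)@_(nth 0%MM L j) :> 'rV[k]_(size L).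
  apply/rowP => j; rewrite summxE !mxE.
  have := congr1 (mcoeff (nth 0%MM L j)) E.
  rewrite mcoeffX nth_uniq // => ->; rewrite raddf_sum /=.
  rewrite big_seq [RHS]big_seq; apply: eq_bigr => p pt; rewrite !mxE.
  apply: (@mcoeffM_min_mdeg d); last by rewrite Ld // mem_nth.
  apply: Jd; rewrite sJ; exact/mem_ideal_gen/ts.
rewrite big_seq; apply: summx_sub => p pt; apply: scalemx_sub.
have ps := ts p pt; have lt : (index p.2 s < size s)%N by rewrite index_mem.
rewrite (_ : \row_j _ = row (Ordinal lt) V) ?row_sub //.
by apply/rowP => j; rewrite !mxE /= nth_index.
Qed.

Lemma is_mu_unique (J : {pred {mpoly k[n]}}) t u : is_mu J t -> is_mu J u -> t = u.
Proof.
move=> [[s <- Js] tmin] [[s' <- Js'] umin].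
by apply/eqP; rewrite eqn_leq tmin ?umin.
Qed.

End MinimalNumberOfGenerators.

(** * Algebraic independence along chains of primes *)

Section PrimeIdeals.
Variable A : comNzRingType.
Implicit Types (P : {pred A}) (a b : A).

Lemma prime_ideal0 P : prime_ideal P -> 0 \in P.
Proof. by case=> -[]. Qed.

Lemma prime_idealD P a b : prime_ideal P -> a \in P -> b \in P -> a + b \in P.
Proof. by case=> -[_ _ PD] _ aP bP; rewrite -[a]mul1r; exact: PD. Qed.

Lemma prime_idealMl P a b : prime_ideal P -> b \in P -> a * b \in P.
Proof. by case=> -[P0 _ PD] _ bP; rewrite -[_ * _]addr0; exact: PD. Qed.

Lemma prime_idealB P a b : prime_ideal P -> a \in P -> b \in P -> a - b \in P.
Proof.
move=> PP aP bP; rewrite -[b]mul1r -mulNr.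
by apply: prime_idealD => //; exact: prime_idealMl.
Qed.

Lemma prime_ideal_sum P (T : Type) (r : seq T) (Q : pred T) (F : T -> A) :
  prime_ideal P -> (forall i, Q i -> F i \in P) -> \sum_(i <- r | Q i) F i \in P.
Proof.
move=> PP FP; elim/big_ind: _ => //; first exact: prime_ideal0.
by move=> u v; exact: prime_idealD.
Qed.

Lemma prime_idealM P a b : prime_ideal P -> a * b \in P -> a \notin P -> b \in P.
Proof. by case=> _ PM /PM /orP[->|]. Qed.

Lemma prime_idealX P a i : prime_ideal P -> a \notin P -> a ^+ i \notin P.
Proof.
move=> PP aP; elim: i => [|i IH]; first by rewrite expr0; case: PP => -[].
by apply: contra IH; rewrite exprS => /(prime_idealM PP); exact.
Qed.

Variables (k : fieldType) (sc : k -> A) (N : nat).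
Hypothesis sc0 : sc 0 = 0.
Hypothesis sc_inj : forall P c, prime_ideal P -> sc c \in P -> c = 0.

(* The polynomial with coefficients [c], of degree < N in each variable,
   evaluated at [fs] in nested Horner form. *)
Fixpoint nested_eval (fs : seq A) (c : seq nat -> k) : A :=
  if fs is f :: fs' then
    \sum_(0 <= i < N) f ^+ i * nested_eval fs' (fun l => c (i :: l))
  else sc (c [::]).

Lemma nested_eval0 fs c :
  (forall l, size l = size fs -> all (gtn N) l -> c l = 0) ->
  nested_eval fs c = 0.
Proof.
elim: fs c => [|f fs IH] c c0 /=; first by rewrite c0.
rewrite big_nat; apply: big1 => i iN; rewrite IH ?mulr0 // => l lf lN.
by apply: c0; rewrite /= ?lf ?lN ?andbT.
Qed.

(* Elements picked along a chain of primes are algebraically independent modulo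
   its bottom: f being outside [Q 0], powers of f cancel, and modulo [Q 1],
   which contains f, one is left with the terms not involving f. *)
Lemma chain_alg_indep fs (Q : nat -> {pred A}) c :
    (forall i, (i <= size fs)%N -> prime_ideal (Q i)) ->
    (forall i, (i < size fs)%N -> [/\ {subset Q i <= Q i.+1},
        fs`_i \in Q i.+1 & fs`_i \notin Q i]) ->
    nested_eval fs c \in Q 0%N ->
  forall l, size l = size fs -> all (gtn N) l -> c l = 0.
Proof.
elim: fs Q c => [|f fs IH] Q c Qp Qs /=.
  by move=> /(sc_inj (Qp 0%N isT)) c0 [].
move=> ev [|i l] //= [lf] /andP[iN lN].
have [Q01 fQ1 fQ0] := Qs 0%N isT.
have Qp0 := Qp 0%N isT; have Qp1 := Qp 1%N isT.
elim/ltn_ind: i iN l lf lN => i IHi iN.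
apply: (IH (fun j => Q j.+1) (fun l => c (i :: l))) => [j jf|j jf|].
- exact: Qp.
- exact: (Qs j.+1).
move: ev; rewrite (@big_cat_nat _ _ _ i) /=; [|by []|exact: ltnW].
rewrite big_nat big1 ?add0r => [|j /= ji]; last first.
  by rewrite nested_eval0 ?mulr0 // => l lf lN; apply: IHi => //; exact: ltn_trans ji iN.
rewrite -{1}[i]add0n big_addn.
under eq_bigr => j _ do rewrite exprD (mulrC (f ^+ j)) -mulrA.
rewrite -mulr_sumr => /(prime_idealM Qp0)/(_ (prime_idealX _ Qp0 fQ0))/Q01.
rewrite big_ltn ?subn_gt0 // mul1r add0n => sQ.
set s := \sum_(1 <= _ < _) _ in sQ; rewrite -[X in X \in _](addrK s).
apply: prime_idealB => //; rewrite /s big_nat; apply: prime_ideal_sum => //.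
case=> // j _; rewrite exprSr mulrC mulrA; exact: (prime_idealMl _ Qp1 fQ1).
Qed.

Fixpoint exponents e : seq (seq nat) :=
  if e is e'.+1 then [seq i :: l | i <- iota 0 N, l <- exponents e'] else [:: [::]].

Lemma mem_exponents e l : (l \in exponents e) = (size l == e) && all (gtn N) l.
Proof.
elim: e l => [|e IH] [|i l] //=.
  by apply/negP => /allpairsP[[i l] []].
apply/allpairsP/andP => /= [[[j l'] /= [jN l'e [-> ->]]]|[le /andP[iN lN]]].
  move: jN l'e; rewrite mem_iota IH /= add0n => -> /andP[/eqP-> ->].
  by rewrite eqxx.
by exists (i, l); rewrite mem_iota IH -eqSS le lN.
Qed.

Lemma size_exponents e : size (exponents e) = (N ^ e)%N.
Proof. by elim: e => // e IH; rewrite /= size_allpairs size_iota IH expnS. Qed.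

Lemma uniq_exponents e : uniq (exponents e).
Proof.
elim: e => // e IH; apply: allpairs_uniq => //; first exact: iota_uniq.
by move=> [i l] [j l'] _ _ [-> ->].
Qed.

Fixpoint monomial_eval (fs : seq A) (l : seq nat) : A :=
  if fs is f :: fs' then
    if l is i :: l' then f ^+ i * monomial_eval fs' l' else 1
  else 1.

Lemma nested_evalE fs c : nested_eval fs c =
  \sum_(l <- exponents (size fs)) sc (c l) * monomial_eval fs l.
Proof.
elim: fs c => [|f fs IH] c /=; first by rewrite big_seq1 mulr1.
rewrite big_allpairs_dep; rewrite /index_iota subn0; apply: eq_bigr => i _.
rewrite IH mulr_sumr; apply: eq_bigr => l _.
by rewrite mulrCA.
Qed.

End PrimeIdeals.

(** * Constants and primes of the Rees algebra *)

Section ReesPrimes.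
Variables (k : fieldType) (n : nat) (I : {pred {mpoly k[n]}}).

Lemma rees_const_subproof (c : k) : c%:MP%:P \in rees I.
Proof.
by apply/asboolP => -[|i]; rewrite coefC //=; exact: (ideal_pow0 I i.+1).
Qed.

Definition rees_const c := ReesAlgebra (rees_const_subproof c).

Lemma rees_const0 : rees_const 0 = 0.
Proof. by apply: val_inj; rewrite /= mpolyC0 polyC0. Qed.

(** Nonzero constants are units, and no prime contains a unit. *)
Lemma rees_const_inj (P : {pred rees_algebra I}) c :
  prime_ideal P -> rees_const c \in P -> c = 0.
Proof.
move=> PP cP; apply/eqP; apply: contraT => c0.
suff E : rees_const c^-1 * rees_const c = 1.
  have := prime_idealMl (rees_const c^-1) PP cP.
  by rewrite E; case: PP => -[_ /negPf->].
by apply: val_inj; rewrite /= -polyCM -mpolyCM mulVf.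
Qed.

Lemma prime_ideal_pi (P : {pred fiber_cone I}) : prime_ideal P ->
  prime_ideal [pred a : rees_algebra I | \pi_(fiber_cone I)%qT a \in P].
Proof.
move=> [[P0 P1 PD] PM]; split; first split.
- by rewrite inE rmorph0.
- by rewrite inE rmorph1.
- by move=> a u v; rewrite !inE rmorphD rmorphM; exact: PD.
by move=> u v; rewrite !inE rmorphM; exact: PM.
Qed.

End ReesPrimes.

(** * Upper bound for the dimension of the fiber cone *)

Section FiberConeDimension.
Variables (k : fieldType) (n : nat) (I : {pred {mpoly k[n]}}).

Lemma fiber_ideal_pi (a : rees_algebra I) :
  (\pi_(fiber_cone I)%qT a == 0) = (a \in @fiber_ideal k n I).
Proof.
rewrite -[a in RHS]subr0 Quotient.idealrBE.
by rewrite -(rmorph0 (\pi_(fiber_cone I)%qT)).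
Qed.

Lemma rees_polyM (a b : rees_algebra I) :
  rees_poly (a * b) = rees_poly a * rees_poly b.
Proof. by []. Qed.

Lemma rees_polyX (a : rees_algebra I) i : rees_poly (a ^+ i) = rees_poly a ^+ i.
Proof. by elim: i => // i IH; rewrite !exprS rees_polyM IH. Qed.

Lemma rees_poly_sum (T : Type) (r : seq T) (F : T -> rees_algebra I) :
  rees_poly (\sum_(i <- r) F i) = \sum_(i <- r) rees_poly (F i).
Proof. by elim: r => [|i r IH]; rewrite ?big_nil // !big_cons -IH. Qed.

(** Every exponent is below [N] and every element has degree at most [B], so degrees in the Rees
    variable grow only linearly in [N]. *)
Lemma size_monomial_eval N B (fs : seq (rees_algebra I)) l :
    (forall f, f \in fs -> (size (rees_poly f) <= B.+1)%N) -> all (gtn N) l ->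
  (size (rees_poly (monomial_eval fs l)) <= (size fs * N * B).+1)%N.
Proof.
have le1 b : (size (1%R : {poly {mpoly k[n]}}) <= b.+1)%N by rewrite size_poly1.
elim: fs l => [|f fs IH] l fsB; first by move=> _; exact: le1.
case: l => [_|i l /=]; first exact: le1.
move=> /andP[iN lN].
have {}IH := IH l (fun g gfs => fsB g (mem_behead (s := f :: fs) gfs)) lN.
have fB := fsB f (mem_head _ _).
rewrite rees_polyX.
apply: leq_trans (size_polyMleq _ _) _.
have fi : (size (rees_poly f ^+ i) <= (N * B).+1)%N.
  apply: leq_trans (size_poly_exp_leq _ _) _.
  rewrite ltnS mulnC; apply: leq_mul; first exact: ltnW.
  by rewrite -subn1 leq_subLR.
apply: (@leq_trans ((N * B).+1 + (size fs * N * B).+1).-1).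
  by rewrite -!subn1 leq_sub2r // leq_add.
by rewrite mulSn mulnDl addSn addnS.
Qed.

Variable G : seq 'X_{1..n}.
Hypothesis IG : I =i monideal (above G).

(* D + 1 elements along a longer chain have N^(D+1) monomials with exponents < N,
   all of degree O(N), hence spanned modulo the fiber ideal by O(N)^D of the
   monomials parametrized by [h]: for N large there is a linear relation. *)
Lemma chain_fiber_cone_le D (h : ('I_D -> nat) -> nat * 'X_{1..n}) :
    (forall i m, gpow G i m -> exists2 b, (forall j, b j <= i)%N & h b = (i, m)) ->
  forall e P, @prime_chain (fiber_cone I) e P -> (e <= D)%N.
Proof.
move=> hG e P [Pp Ps]; rewrite leqNgt; apply/negP => De.
pose Q i : {pred rees_algebra I} := [pred a | \pi_(fiber_cone I)%qT a \in P i].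
have Qp i : (i <= e)%N -> prime_ideal (Q i) by move=> ie; exact/prime_ideal_pi/Pp.
have /choice[F HF] i : exists f, (i < e)%N ->
    [/\ {subset Q i <= Q i.+1}, f \in Q i.+1 & f \notin Q i].
  case: (ltnP i e) => ie; last by exists 0.
  have [sub /existsNP[x /not_implyP[xP /negP xnP]]] := Ps i ie.
  by exists (repr x) => _; split=> [a||]; rewrite ?inE ?reprK //; exact: sub.
pose d := D.+1; pose fs := mkseq F d.
pose B := \max_(i < d) size (rees_poly (F i)).
have fsB f : f \in fs -> (size (rees_poly f) <= B.+1)%N.
  move=> /mapP[i]; rewrite mem_iota /= => id ->.
  exact/leqW/(leq_bigmax (Ordinal id)).
(* Chosen so that [C] is smaller than [E]: [T + 1] is at most [d * B + 1] times [N], and the [D]-th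
   power of [d * B + 1] is below [N]. *)
pose N := ((d * B).+1 ^ D).+1; pose T := (d * N * B)%N.
pose E := exponents N d; pose C := {ffun 'I_D -> 'I_T.+1}.
have CE : (#|C| < size E)%N.
  rewrite card_ffun !card_ord size_exponents /d expnS.
  have : (T.+1 <= (d * B).+1 * N)%N by rewrite /T; nia.
  move=> TN; apply: (@leq_ltn_trans (((d * B).+1 * N) ^ D)%N).
    by case: (D) TN => // D' TN; rewrite leq_exp2r.
  by rewrite expnMn ltn_pmul2r ?expn_gt0.
(* Each row lists the coefficients of one monomial in [fs] at the positions parametrized by [h]; a
   nonzero vector killed by [M] gives the linear relation [c]. *)
pose M := \matrix_(i < size E, j < #|C|)
  let c := h (fun x => (enum_val j : C) x) in
  ((rees_poly (monomial_eval fs (nth [::] E i)))`_(c.1))@_(c.2).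
pose v := nz_row (kermx M).
have v0 : v != 0.
  rewrite nz_row_eq0 -mxrank_eq0 mxrank_ker subn_eq0 -ltnNge.
  exact: leq_ltn_trans (rank_leq_col _) CE.
have vM : v *m M = 0 by apply/sub_kermxP/nz_row_sub.
pose c l := if insub (index l E) is Some i then v 0 i else 0.
have cE (i : 'I_(size E)) : c (nth [::] E i) = v 0 i.
  by rewrite /c index_uniq ?uniq_exponents // valK.
have ev : nested_eval (@rees_const k n I) N fs c \in Q 0%N.
  rewrite inE; suff -> : \pi_(fiber_cone I)%qT
    (nested_eval (@rees_const k n I) N fs c) = 0 by case: (Pp 0%N isT) => -[].
  apply/eqP; rewrite fiber_ideal_pi; apply/asboolP => i.
  rewrite (monideal_max_pow IG); apply/monidealP => m.
  set a := nested_eval _ _ _ _; move=> am.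
  (* An exponent of [a] in degree [i] lies above a product [g] of [i] generators, and only equality
     has to be excluded: there the coefficient vanishes by degree if [T < i], and otherwise is an
     entry of [v *m M]. *)
  have := asboolP _ (rees_polyP a) i; rewrite (monideal_pow IG).
  move=> /monidealP/(_ m am) [g gi gm]; exists g; split=> //.
  apply/eqP => gmE; move: am; rewrite mcoeff_msupp => /eqP; apply.
  have aE : rees_poly a = \sum_(j < size E)
      (v 0 j)%:MP%:P * rees_poly (monomial_eval fs (nth [::] E j)).
    rewrite /a nested_evalE size_mkseq -/E (big_nth [::]) big_mkord.
    rewrite rees_poly_sum; apply: eq_bigr => j _.
    by rewrite cE.
  rewrite aE coef_sum raddf_sum /=.
  under eq_bigr => j _ do rewrite coefCM mcoeffCM.
  have sE (j : 'I_(size E)) :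
      (size (rees_poly (monomial_eval fs (nth [::] E j))) <= T.+1)%N.
    have : nth [::] E j \in E by exact: mem_nth.
    rewrite mem_exponents => /andP[_ jN].
    have := size_monomial_eval fsB jN; by rewrite size_mkseq.
  case: (ltnP T i) => Ti.
    apply: big1 => j _; rewrite nth_default ?mcoeff0 ?mulr0 //.
    exact: leq_trans (sE j) Ti.
  have [b bi hb] := hG _ _ gi.
  pose g' : C := [ffun j => inord (b j)].
  have g'E : (fun x => g' x : nat) = b.
    by apply: funext => x; rewrite ffunE inordK // ltnS (leq_trans (bi x)).
  have := congr1 (fun w : 'rV_#|C| => w 0 (enum_rank g')) vM.
  rewrite !mxE => vM0; rewrite -[RHS]vM0; apply: eq_bigr => j _.
  by rewrite !mxE enum_rankK g'E hb /= gmE.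
have c0 := chain_alg_indep (@rees_const0 k n I) (@rees_const_inj k n I) _ _ ev.
case/negP: v0; apply/eqP/rowP => i; rewrite mxE -cE.
have : nth [::] E i \in E by exact: mem_nth.
rewrite mem_exponents => /andP[/eqP si iN].
apply: c0 => //; rewrite size_mkseq // => j jd.
  by apply: Qp; lia.
rewrite nth_mkseq //; apply: HF; lia.
Qed.

End FiberConeDimension.

(** * Primes of the fiber cone from primes of the Rees algebra *)

Section PushPrime.
Variables (k : fieldType) (n : nat) (I : {pred {mpoly k[n]}}).
Implicit Types (Q : {pred rees_algebra I}).

(** The image of [Q] in the quotient, read off canonical representatives; the choice is harmless
    once [Q] contains the fiber ideal. *)
Definition push_ideal Q : {pred fiber_cone I} := [pred q | repr q \in Q].

Lemma push_idealE Q a : prime_ideal Q -> {subset @fiber_ideal k n I <= Q} ->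
  (\pi_(fiber_cone I)%qT a \in push_ideal Q) = (a \in Q).
Proof.
move=> Qp FQ; rewrite inE /=; set b := repr _.
have ab : a - b \in Q.
  by apply: FQ; rewrite -fiber_ideal_pi rmorphB /= reprK subrr.
apply/idP/idP => [bQ|aQ]; first by rewrite -[a](subrK b) prime_idealD.
by rewrite -[b](subKr a) prime_idealB.
Qed.

Lemma prime_push_ideal Q : prime_ideal Q -> {subset @fiber_ideal k n I <= Q} ->
  prime_ideal (push_ideal Q).
Proof.
move=> Qp FQ; have E a := push_idealE a Qp FQ.
have [[Q0 Q1 QD] QM] := Qp; split; first split.
- by rewrite -(rmorph0 (\pi_(fiber_cone I)%qT)) E.
- by rewrite -(rmorph1 (\pi_(fiber_cone I)%qT)) E.
- move=> a u v; rewrite -[a]reprK -[u]reprK -[v]reprK -rmorphM -rmorphD !E.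
  exact: QD.
move=> u v; rewrite -[u]reprK -[v]reprK -rmorphM !E; exact: QM.
Qed.

End PushPrime.

(** * Restriction of polynomials to a set of exponents *)

Section Restriction.
Variables (k : fieldType) (n : nat).
Implicit Types (f : {mpoly k[n]}) (S : pred 'X_{1..n}).

Definition restrict S f := \sum_(m <- msupp f | S m) f@_m *: 'X_[m].

Lemma mcoeff_restrict S f m : (restrict S f)@_m = if S m then f@_m else 0.
Proof.
rewrite raddf_sum /=; case: (boolP (m \in msupp f)) => [mf|]; last first.
  move=> mf; rewrite (memN_msupp_eq0 mf) if_same big_seq_cond big1 // => m'.
  move=> /andP[m'f _]; rewrite mcoeffZ mcoeffX; case: eqP mf m'f => [->|].
    by move=> /negPf->.
  by rewrite mulr0.
rewrite big_mkcond (bigD1_seq m) //= big1 ?addr0 => [|m' m'm].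
  by case: (S m) => //; rewrite mcoeffZ mcoeffX eqxx mulr1.
by case: (S m') => //; rewrite mcoeffZ mcoeffX (negPf m'm) mulr0.
Qed.

End Restriction.

Lemma if_sumr (V : nmodType) (T : Type) (r : seq T) (P : pred T) (F : T -> V) (c : bool) :
  (if c then \sum_(i <- r | P i) F i else 0) =
  \sum_(i <- r | P i) (if c then F i else 0).
Proof. by case: c => //; rewrite big1. Qed.

(** * Generators without multiplicative relations: the fiber cone is a polynomial ring *)

Section FreeMonomials.
Variables (k : fieldType) (n d r : nat) (g : 'I_d -> 'X_{1..n}).
Implicit Types (b : 'X_{1..d}) (m : 'X_{1..n}).

Definition combo b : 'X_{1..n} := (\sum_j g j *+ b j)%MM.

Lemma combo0 : combo 0%MM = 0%MM.
Proof. by rewrite /combo big1 // => j _; rewrite mnm0E. Qed.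

Lemma comboD b c : combo (b + c)%MM = (combo b + combo c)%MM.
Proof.
apply/mnmP => i; rewrite mnmDE !mnm_sumE -big_split; apply: eq_bigr => j _ /=.
by rewrite !mulmnE mnmDE mulnDr.
Qed.

Lemma combo1 j : combo U_(j)%MM = g j.
Proof.
apply/mnmP => i; rewrite mnm_sumE (bigD1 j) //= big1 ?addn0.
  by rewrite mulmnE mnm1E eqxx muln1.
by move=> l lj; rewrite mulmnE mnm1E eq_sym (negPf lj) muln0.
Qed.

Lemma gpow_combo i m :
  gpow (codom g) i m <-> exists2 b, mdeg b = i & combo b = m.
Proof.
elim: i m => [|i IH] m /=.
  split=> [->|[b /eqP]]; first by exists 0%MM; rewrite ?mdeg0 ?combo0.
  by rewrite mdeg_eq0 => /eqP-> <-; rewrite combo0.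
split=> [[h [m' [/codomP[j ->] /IH[b bi <-] ->]]]|[b bi <-]].
  by exists (U_(j) + b)%MM; rewrite ?mdegD ?mdeg1 ?bi ?comboD ?combo1.
have [j bj] : exists j, b j != 0%N.
  apply/existsP; apply: contra_eqT bi => /existsPn b0.
  by rewrite (_ : b = 0%MM) ?mdeg0 //; apply/mnmP => j; have /negPn/eqP := b0 j; rewrite mnm0E.
have lejb : (U_(j) <= b)%MM by rewrite lep1mP.
exists (g j), (combo (b - U_(j))%MM); split; first exact: codom_f.
  apply/IH; exists (b - U_(j))%MM => //.
  by move: bi; rewrite -{1}(submK lejb) mdegD mdeg1 addn1 => -[].
by rewrite -{1}(submK lejb) comboD combo1 addmC.
Qed.

Hypothesis gr : forall j, mdeg (g j) = r.
Hypothesis combo_inj : forall b c, mdeg b = mdeg c -> combo b = combo c -> b = c.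

Lemma g_inj : injective g.
Proof.
move=> i j gij; apply/eqP; rewrite -(@eq_mnm1 d) (combo_inj (b := U_(i)) (c := U_(j))) //.
  by rewrite !mdeg1.
by rewrite !combo1.
Qed.

(** Increasing [t] shrinks the face, hence enlarges the kernel of the restriction to it. *)
Definition face t i m : bool :=
  `[< exists b, [/\ mdeg b = i, combo b = m & forall j : 'I_d, (j < t)%N -> b j = 0%N] >].

Lemma mdeg_combo b : mdeg (combo b) = (mdeg b * r)%N.
Proof.
apply: (@gpow_mdeg n (codom g)) => [_ /codomP[j ->] //|].
by apply/gpow_combo; exists b.
Qed.

Lemma above_combo m i b : mdeg b = i -> (combo b <= m)%MM ->
  (i * r <= mdeg m)%N /\ (mdeg m = (i * r)%N -> m = combo b).
Proof.
move=> bi bm; rewrite -(submK bm) mdegD mdeg_combo bi; split; first exact: leq_addl.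
move=> /eqP; rewrite -[X in _ == X]add0n eqn_add2r mdeg_eq0 => /eqP->.
by rewrite add0m.
Qed.

(* A product of two monomials of the Rees algebra lies on the face of the
   generators [g j], t <= j, only if both factors do: degrees force the factors
   to be products of generators, and [combo_inj] identifies the exponents.
   Hence restriction to the face is multiplicative and its kernel is prime. *)
Lemma faceD t i1 i2 m1 m2 :
    (exists2 h, gpow (codom g) i1 h & (h <= m1)%MM) ->
    (exists2 h, gpow (codom g) i2 h & (h <= m2)%MM) ->
  face t (i1 + i2) (m1 + m2)%MM = face t i1 m1 && face t i2 m2.
Proof.
move=> [h1 /gpow_combo[b1 bi1 <-] le1] [h2 /gpow_combo[b2 bi2 <-] le2].
apply/asboolP/andP => [[b [bi bm bt]]|[/asboolP[c1 [ci1 <- ct1]] /asboolP[c2 [ci2 <- ct2]]]].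
  have [d1 E1] := above_combo bi1 le1; have [d2 E2] := above_combo bi2 le2.
  have : mdeg (m1 + m2)%MM = ((i1 + i2) * r)%N by rewrite -bm mdeg_combo bi.
  rewrite mdegD mulnDl => degE.
  have {}E1 : m1 = combo b1 by apply: E1; lia.
  have {}E2 : m2 = combo b2 by apply: E2; lia.
  have bE : b = (b1 + b2)%MM.
    by apply: combo_inj; rewrite ?mdegD ?bi1 ?bi2 // comboD bm E1 E2.
  split; apply/asboolP; [exists b1 | exists b2]; split=> // j /bt;
    rewrite bE mnmDE; lia.
exists (c1 + c2)%MM; split; [by rewrite mdegD ci1 ci2|exact: comboD|].
by move=> j jt; rewrite mnmDE ct1 ?ct2.
Qed.

Variable I : {pred {mpoly k[n]}}.
Hypothesis IG : I =i monideal (above (codom g)).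

Definition face_proj t (p : {poly {mpoly k[n]}}) : {poly {mpoly k[n]}} :=
  \poly_(i < size p) restrict (face t i) p`_i.

Lemma coef_face_proj t p i m :
  ((face_proj t p)`_i)@_m = if face t i m then (p`_i)@_m else 0.
Proof.
rewrite coef_poly; case: ltnP => [_|sp]; first exact: mcoeff_restrict.
by rewrite (nth_default _ sp) mcoeff0 if_same.
Qed.

Lemma face_projD t p q : face_proj t (p + q) = face_proj t p + face_proj t q.
Proof.
apply/polyP => i; apply/mpolyP => m; rewrite coefD mcoeffD !coef_face_proj.
by rewrite coefD mcoeffD; case: ifP => // _; rewrite addr0.
Qed.

Lemma rees_supp (a : rees_algebra I) i m : ((rees_poly a)`_i)@_m != 0 ->
  exists2 h, gpow (codom g) i h & (h <= m)%MM.
Proof.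
rewrite -mcoeff_msupp; have := asboolP _ (rees_polyP a) i.
by rewrite (monideal_pow IG) => /monidealP; exact.
Qed.

Lemma face_projM t (a b : rees_algebra I) :
  face_proj t (rees_poly (a * b)) =
  face_proj t (rees_poly a) * face_proj t (rees_poly b).
Proof.
apply/polyP => i; apply/mpolyP => m; rewrite coef_face_proj rees_polyM !coefM.
rewrite !raddf_sum /= if_sumr; apply: eq_bigr => j _.
rewrite !mcoeffM if_sumr; apply: eq_bigr => -[[m1 h1] [m2 h2]] /= /eqP mE.
rewrite {}mE !coef_face_proj.
(* Zero coefficients contribute nothing on either side; the other exponents lie above products of
   generators, as [faceD] requires. *)
case: (eqVneq ((rees_poly a)`_j)@_m1 0) => [->|/rees_supp ha].
  by rewrite mul0r !if_same mul0r.
case: (eqVneq ((rees_poly b)`_(i - j))@_m2 0) => [->|/rees_supp hb].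
  by rewrite mulr0 !if_same mulr0.
have ji : (j <= i)%N by rewrite -ltnS.
rewrite -{1}(subnKC ji) (faceD t ha hb).
by case: (face t j m1); case: (face t (i - j) m2); rewrite ?mul0r ?mulr0.
Qed.

Definition face_prime t : {pred rees_algebra I} :=
  [pred a | face_proj t (rees_poly a) == 0].

Lemma face_primeP t a :
  reflect (forall b, (forall j : 'I_d, (j < t)%N -> b j = 0%N) ->
             ((rees_poly a)`_(mdeg b))@_(combo b) = 0)
    (a \in face_prime t).
Proof.
apply: (iffP eqP) => [E b bt|E].
  have := congr1 (fun p : {poly {mpoly k[n]}} => (p`_(mdeg b))@_(combo b)) E.
  rewrite coef0 mcoeff0 coef_face_proj => /=.
  by have -> : face t (mdeg b) (combo b) by apply/asboolP; exists b.
apply/polyP => i; apply/mpolyP => m; rewrite coef_face_proj coef0 mcoeff0.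
by case: ifP => // /asboolP[b [<- <-]] /E.
Qed.

Lemma face_prime_prime t : prime_ideal (face_prime t).
Proof.
split; first split.
- by apply/face_primeP => b _; rewrite coef0 mcoeff0.
- apply/negP => /face_primeP E.
  have /eqP := E 0%MM (fun j _ => mnm0E j); rewrite mdeg0 combo0 coef1 mcoeff1 eqxx.
  by rewrite oner_eq0.
- move=> a u v /eqP u0 /eqP v0; rewrite inE; apply/eqP.
  have -> : rees_poly (a * u + v) = rees_poly (a * u) + rees_poly v by [].
  by rewrite face_projD face_projM u0 v0 mulr0 addr0.
by move=> u v; rewrite !inE face_projM mulf_eq0.
Qed.

(** A strict multiple of a product of [i] generators has degree above [i * r], so it is not itself
    such a product. *)
Lemma fiber_sub_face_prime t : {subset @fiber_ideal k n I <= face_prime t}.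
Proof.
move=> a /asboolP aF; apply/face_primeP => b _.
have := aF (mdeg b); rewrite (monideal_max_pow IG) => /monidealP aS.
apply: memN_msupp_eq0; apply/negP => /aS[h [/gpow_combo[c cb <-] le neq]].
case/negP: neq; apply/eqP.
have [_ ->] := above_combo cb le => //; exact: mdeg_combo.
Qed.

Lemma rees_linear_subproof j : 'X_[g j] *: 'X \in rees I.
Proof.
apply/asboolP => -[|[|i]]; rewrite coefZ coefX ?mulr0 ?mulr1 //=.
- rewrite (monideal_pow IG 1); apply/monidealX; exists (g j); rewrite ?lepm_refl //.
  exact/gpow1/codom_f.
exact: (ideal_pow0 I i.+2).
Qed.

(** Inclusions are strict because the generator of index [t], placed in degree one, lies in the
    prime of [t + 1] but not in that of [t]. *)
Lemma chain_face_prime :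
  @prime_chain (fiber_cone I) d (fun t => push_ideal (face_prime t)).
Proof.
have pE t a := push_idealE a (face_prime_prime t) (@fiber_sub_face_prime t).
split=> t td.
  exact: prime_push_ideal (face_prime_prime t) (@fiber_sub_face_prime t).
split=> [a|].
  rewrite -[a]reprK !pE => /face_primeP aP; apply/face_primeP => b bt.
  by apply: aP => j jt; apply: bt; exact: leqW.
pose x := ReesAlgebra (rees_linear_subproof (Ordinal td)).
move=> /(_ (\pi_(fiber_cone I)%qT x)); rewrite !pE => xP.
have: x \in face_prime t.
  apply: xP; apply/face_primeP => b bt; rewrite /= coefZ coefX.
  case: eqP => [b1|]; last by rewrite mulr0 mcoeff0.
  rewrite mulr1 mcoeffX; case: eqP => // gb.
  have /mnmP/(_ (Ordinal td)) : b = U_(Ordinal td)%MM.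
    by apply: combo_inj; rewrite ?mdeg1 ?combo1.
  by rewrite bt //= mnm1E eqxx.
have U0 (j : 'I_d) : (j < t)%N -> U_(Ordinal td)%MM j = 0%N.
  move=> jt; rewrite mnm1E; case: eqP => // /(congr1 val) /= E.
  by rewrite -E ltnn in jt.
move/face_primeP => /(_ _ U0)/eqP; rewrite mdeg1 combo1.
by rewrite /= coefZ coefX mulr1 mcoeffX eqxx oner_eq0.
Qed.

(** The face primes give the lower bound; for the upper one, products of generators are parametrized
    by their [d] exponents. *)
Lemma krull_dim_fiber_cone_free : is_krull_dim (fiber_cone I) d.
Proof.
split; first by exists (fun t => push_ideal (face_prime t)); exact: chain_face_prime.
apply: (chain_fiber_cone_le IG
  (h := fun b : 'I_d -> nat => (\sum_j b j, combo [multinom b j | j < d])%N)).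
move=> i m.
move=> /gpow_combo[b <- <-]; exists b.
  by move=> j; rewrite mdegE (bigD1 j) //= leq_addr.
by rewrite mdegE; congr (_, combo _); apply/mnmP => j; rewrite mnmE.
Qed.

Definition sorted_pairs : seq ('I_d * 'I_d) :=
  enum [pred p : 'I_d * 'I_d | (p.1 <= p.2)%N].

Lemma size_sorted_pairs : size sorted_pairs = 'C(d.+1, 2).
Proof.
rewrite -cardE -sum1_card (eq_bigl (fun p : 'I_d * 'I_d => true && (p.1 <= p.2)%N)) //.
rewrite -(pair_big_dep predT (fun i j : 'I_d => (i <= j)%N) (fun _ _ => 1%N)) /=.
rewrite (exchange_big_dep predT) //= -bin2_sum big_nat_recl // add0n big_mkord.
apply: eq_bigr => j _; rewrite sum1_card -(card_ord j.+1).
have winj : injective (widen_ord (ltn_ord j)).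
  by move=> x y /(congr1 val) /= E; exact: val_inj.
rewrite -(card_imset _ winj).
apply: eq_card => i; apply/idP/imsetP => [ij|[x _ ->]]; last exact: (ltn_ord x).
by exists (Ordinal (ij : (i < j.+1)%N)) => //; exact: val_inj.
Qed.

Lemma mnm1_add_inj (i j i' j' : 'I_d) : (i <= j)%N -> (i' <= j')%N ->
  (U_(i) + U_(j) = U_(i') + U_(j'))%MM -> (i, j) = (i', j').
Proof.
move=> ij ij' E.
have cancel x y z : (U_(x) + U_(y) = U_(x) + U_(z) :> 'X_{1..d})%MM -> y = z.
  by move/addmI/eqP; rewrite eq_mnm1 => /eqP.
have : i == i' \/ i == j'.
  move/mnmP/(_ i): E; rewrite !mnmDE !mnm1E eqxx.
  by rewrite ![_ == i]eq_sym; case: (i == i'); case: (i == j'); auto.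
case=> /eqP ii'; first by move: E; rewrite ii' => /cancel->.
move: E; rewrite ii' (addmC U_(i')%MM) => /cancel ji'.
have ij_eq : i = j by apply: val_inj; apply/eqP; rewrite eqn_leq ij ii' ji'.
by rewrite -ji' -ii' ij_eq.
Qed.

(** By [combo_inj], distinct unordered pairs of generators have distinct products. *)
Lemma mu_square_free : is_mu (ideal_pow I 2) 'C(d.+1, 2).
Proof.
rewrite -size_sorted_pairs -(size_map (fun p => (g p.1 + g p.2)%MM)).
apply: (@mu_equigenerated k n (r + r)).
- rewrite map_inj_in_uniq ?enum_uniq // => -[i j] [i' j'].
  rewrite !mem_enum !inE /= => ij ij'; rewrite -!combo1 -!comboD => /combo_inj E.
  by apply: mnm1_add_inj => //; apply: E; rewrite !mdegD !mdeg1.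
- by move=> _ /mapP[p _ ->]; rewrite mdegD !gr.
move=> f; rewrite (monideal_pow IG 2).
apply/monidealP/monidealP => H m /H [h].
  move=> /gpow2[_ [_ [/codomP[i ->] /codomP[j ->] ->]]] le.
  exists (g i + g j)%MM => //; apply/mapP.
  case: (leqP i j) => ij; first by exists (i, j); rewrite ?mem_enum.
  by exists (j, i); rewrite ?mem_enum ?inE ?(ltnW ij) //= addmC.
move=> /mapP[p _ ->] le; exists (g p.1 + g p.2)%MM => //.
by apply/gpow2; exists (g p.1), (g p.2); rewrite !codom_f.
Qed.

Lemma bin2_double e : ('C(e, 2) * 2 = e * e.-1)%N.
Proof. by rewrite -[X in (_ * X)%N]/(2`!) bin_ffact ffactnS ffactn1. Qed.

(** The analytic spread and the number of generators are both [d], and Freiman's equality reads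
    [C(d + 1, 2) = d ^ 2 - C(d, 2)]. *)
Lemma Freiman_free : Freiman I.
Proof.
have mem_above h : h \in codom g -> 'X_[h] \in I.
  by move=> hg; rewrite IG; apply/monidealX; exists h; rewrite ?lepm_refl.
split.
- exists (fun m : 'X_{1..n} => m \in codom g) => f; rewrite IG; apply/idP/idP; move: f.
    apply: monideal_sub_gen => m [h hG hm].
    rewrite -(submK hm) mpolyXD; apply/ideal_genM/mem_ideal_gen.
    by apply/asboolP; exists h.
  apply: gen_sub_monideal => [m m' [h hG hm]|f /asboolP[m mG ->]].
    by exists h => //; exact: lepm_trans hm (lem_addl _ _).
  by apply/monidealX; exists m; rewrite ?lepm_refl.
- exists (fun _ => 1%N); split=> //; exists r => c [].
  rewrite IG => /monidealX[h /[dup] hg /codomP[j hE] hc] cmin.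
  rewrite -(cmin _ (mem_above _ hg) hc) hE -(gr j) mdegE.
  by apply: eq_bigr => i _; rewrite mul1n.
exists d, d, 'C(d.+1, 2); split.
- exact: krull_dim_fiber_cone_free.
- rewrite -[X in is_mu _ X](card_ord d) -(size_codom g); apply: (@mu_equigenerated k n r) => //.
    by apply/injectiveP/g_inj.
  by move=> _ /codomP[j ->].
- exact: mu_square_free.
have := bin2_double d; rewrite binS bin1 => D.
by move: D; case: (d) => [|e] /=; nia.
Qed.

End FreeMonomials.

(** * Squarefree equigenerated ideals *)

Section SquarefreeEquigenerated.
Variables (k : fieldType) (n r : nat) (G : seq 'X_{1..n}).
Variable I : {pred {mpoly k[n]}}.
Hypothesis IG : I =i monideal (above G).
Hypotheses (uG : uniq G) (r_gt0 : (0 < r)%N).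
Hypothesis Gr : forall g, g \in G -> mdeg g = r.
Hypothesis Gle1 : forall g i, g \in G -> (g i <= 1)%N.

Definition double_sums : seq 'X_{1..n} :=
  undup [seq (g + h)%MM | g <- G, h <- G].

Lemma mu_square : is_mu (ideal_pow I 2) (size double_sums).
Proof.
apply: (@mu_equigenerated k n (r + r)); first exact: undup_uniq.
  by move=> x; rewrite mem_undup => /allpairsP[[g h] [/Gr + /Gr + ->{x}]] /=; rewrite mdegD => -> ->.
move=> f; rewrite (monideal_pow IG 2).
apply/monidealP/monidealP => H m /H [x].
  move=> /gpow2[g [h [gG hG ->{x}]]] le; exists (g + h)%MM => //.
  by rewrite mem_undup; apply/allpairsP; exists (g, h).
rewrite mem_undup => /allpairsP[[g h] /= [gG hG ->{x}]] le; exists (g + h)%MM => //.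
by apply/gpow2; exists g, h.
Qed.

(** A product of [i] squarefree generators has its [n] exponents at most [i], and dividing its
    degree by [r] recovers [i]; so [n] parameters suffice. *)
Lemma chain_squarefree_le e P : @prime_chain (fiber_cone I) e P -> (e <= n)%N.
Proof.
move: e P; apply: (chain_fiber_cone_le IG
  (h := fun b : 'I_n -> nat => ((\sum_j b j) %/ r, [multinom b j | j < n])%N)).
move=> i m gm; exists (fun j => m j).
  move=> j; elim: i m gm => [|i IH] m /=; first by move->; rewrite mnm0E.
  move=> [g [m' [gG /IH mi ->]]]; rewrite mnmDE -add1n leq_add // ?Gle1 //.
congr (_, _); last by apply/mnmP => j; rewrite mnmE.
by rewrite -mdegE (gpow_mdeg Gr gm) mulnK.
Qed.

(** Freiman's equality over the natural numbers; of the analytic spread only the bound by [n] is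
    retained. *)
Lemma Freiman_squarefree_sums : Freiman I ->
  exists2 l, (l <= n)%N & (size double_sums + 'C(l, 2) = l * size G)%N.
Proof.
move=> [_ _ [l [mu1 [mu2 [[[P Pl] _] h1 h2 E]]]]].
exists l; first exact: chain_squarefree_le Pl.
rewrite (is_mu_unique h1 (mu_equigenerated uG Gr IG)) in E.
rewrite (is_mu_unique h2 mu_square) in E.
lia.
Qed.

End SquarefreeEquigenerated.

(** * Cover ideals *)

Section CoverIdeal.
Variables (k : fieldType) (n : nat) (H : sgraph 'I_n).
Implicit Types (A B : {set 'I_n}) (m : 'X_{1..n}).

Definition independent A : bool := [forall x in A, forall y in A, ~~ H x y].

Definition max_independent A : bool :=
  independent A && [forall v, (v \notin A) ==> [exists a in A, H v a]].

Lemma independentP A :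
  reflect {in A &, forall x y, ~~ H x y} (independent A).
Proof.
apply: (iffP forall_inP) => [HA x y xA yA|HA x xA].
  exact: (forall_inP (HA x xA)).
by apply/forall_inP => y yA; exact: HA.
Qed.

Lemma max_independentP A : reflect
  ({in A &, forall x y, ~~ H x y} /\
   forall v, v \notin A -> exists2 a, a \in A & H v a)
  (max_independent A).
Proof.
apply: (iffP andP) => -[/independentP iA mA]; split=> //.
  by move=> v /(implyP (forallP mA v)) /exists_inP.
by apply/forallP => v; apply/implyP => /mA/exists_inP.
Qed.

Lemma max_independent_sub A B :
  max_independent A -> max_independent B -> A \subset B -> A = B.
Proof.
move=> /max_independentP[_ mA] /max_independentP[iB _] AB.
apply/eqP; rewrite eqEsubset AB; apply/subsetP => v vB.
apply: contraT => /mA[a /(subsetP AB) aB].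
by rewrite (negPf (iB v a vB aB)).
Qed.

Lemma ex_max_independent A : independent A ->
  exists2 B, max_independent B & A \subset B.
Proof.
move=> iA; have [B /maxsetP[iB mB] AB] := @maxset_exists _ independent A iA.
exists B => //; apply/max_independentP; split; first exact/independentP.
move=> v vB; apply/exists_inP; apply: contraNT vB => /exists_inPn nv.
rewrite -(mB (v |: B)) ?setU11 ?subsetUr //; apply/independentP => x y.
rewrite !inE => /orP[/eqP->|xB] /orP[/eqP->|yB].
- by rewrite adj_irr.
- exact: nv.
- by rewrite adj_sym; exact: nv.
exact: (independentP _ iB).
Qed.

(** For independent [A] the complement is a vertex cover; larger sets give smaller monomials. *)
Definition cover_mon A : 'X_{1..n} := [multinom (i \notin A : nat) | i < n].

Lemma cover_monE A i : cover_mon A i = (i \notin A).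
Proof. exact: mnmE. Qed.

Lemma cover_mon_le A B : (cover_mon A <= cover_mon B)%MM = (B \subset A).
Proof.
apply/mnm_lepP/subsetP => [le i|BA i]; last first.
  by rewrite !cover_monE; case: (boolP (i \in A)) => // /(contraNN (BA i)) ->.
by move: (le i); rewrite !cover_monE; case: (i \in A); case: (i \in B).
Qed.

Lemma cover_mon_inj : injective cover_mon.
Proof.
move=> A B E; apply/eqP; rewrite eqEsubset -!cover_mon_le E.
by rewrite !lepm_refl.
Qed.

Lemma mdeg_cover_mon A : mdeg (cover_mon A) = (n - #|A|)%N.
Proof.
have -> : (n - #|A|)%N = #|[predC A]| by rewrite -{1}(card_ord n) -(cardC (mem A)) addKn.
rewrite mdegE -sum1_card [RHS]big_mkcond.
by apply: eq_bigr => i _; rewrite cover_monE inE; case: (i \in A).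
Qed.

Definition cover_mons : seq 'X_{1..n} :=
  [seq cover_mon A | A <- enum max_independent].

Lemma cover_monsP m :
  reflect (exists2 A, max_independent A & m = cover_mon A) (m \in cover_mons).
Proof.
by apply: (iffP mapP) => -[A]; [rewrite mem_enum|]; exists A; rewrite ?mem_enum.
Qed.

Lemma uniq_cover_mons : uniq cover_mons.
Proof. by rewrite map_inj_uniq ?enum_uniq //; exact: cover_mon_inj. Qed.

Lemma edge_ideal_memE (i j : 'I_n) :
  ideal_gen (pred2 'X_i 'X_j) =i
    @monideal k n (fun m => (m i != 0%N) || (m j != 0%N)).
Proof.
move=> f; apply/idP/idP; move: f.
  apply: gen_sub_monideal => [m m'|f]; first by rewrite !mnmDE; lia.
  by rewrite inE => /orP[] /eqP->; apply/monidealX; rewrite !mnm1E eqxx ?orbT.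
apply: monideal_sub_gen => m /orP[]; rewrite -lep1mP => le;
  by rewrite -(submK le) mpolyXD; apply/ideal_genM/mem_ideal_gen; rewrite inE eqxx ?orbT.
Qed.

(** A monomial lies in the ideal when the variables missing from it form an independent set;
    extending that set to a maximal one yields a generator dividing the monomial. *)
Lemma cover_idealE : cover_ideal k H =i monideal (above cover_mons).
Proof.
move=> f; apply/asboolP/monidealP => [HC m mf|HC i j ij].
  have mE i j : H i j -> (m i != 0%N) || (m j != 0%N).
    by move=> /HC; rewrite edge_ideal_memE => /monidealP; exact.
  have [|A mA sA] := @ex_max_independent [set i | m i == 0%N].
    apply/independentP => x y; rewrite !inE => /eqP x0 /eqP y0.
    by apply/negP => /mE; rewrite x0 y0.
  exists (cover_mon A); first by apply/cover_monsP; exists A.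
  apply/mnm_lepP => i; rewrite cover_monE; case: (boolP (i \in A)) => //= iA.
  by rewrite lt0n; apply: contraNN iA => mi; apply: (subsetP sA); rewrite inE.
rewrite edge_ideal_memE; apply/monidealP => m /HC[_ /cover_monsP[A + ->]].
move=> /max_independentP[iA _] /mnm_lepP le.
have := le i; have := le j; rewrite !cover_monE.
case: (boolP (i \in A)) => iA'; case: (boolP (j \in A)) => jA'; try lia.
by have := iA i j iA' jA'; rewrite ij.
Qed.

Lemma min_mon_gen_cover A : max_independent A ->
  min_mon_gen (cover_ideal k H) (cover_mon A).
Proof.
move=> mA; split=> [|m]; rewrite cover_idealE.
  apply/monidealX; exists (cover_mon A); rewrite ?lepm_refl //.
  by apply/cover_monsP; exists A.
move=> /monidealX[_ /cover_monsP[B mB ->] Bm] mA'.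
have := lepm_trans Bm mA'; rewrite cover_mon_le => /(max_independent_sub mA mB) E.
by rewrite -E in Bm; apply/mnmP => i; apply/eqP; rewrite eqn_leq !(mnm_lepP _ _).
Qed.

(** Taking complements replaces the common weighted degree of the generators by the total weight
    minus it. *)
Lemma quasi_equigenerated_cover : quasi_equigenerated (cover_ideal k H) ->
  exists2 a : 'I_n -> nat, (forall i, (0 < a i)%N) &
  exists d, forall A, max_independent A -> (\sum_(i in A) a i)%N = d.
Proof.
move=> [a [a0 [d ad]]]; exists a => //; exists (\sum_i a i - d)%N => A mA.
rewrite -(ad _ (min_mon_gen_cover mA)) [X in (X - _)%N](bigID (mem A)) /=.
rewrite [X in (_ + X)%N](_ : _ = \sum_i a i * cover_mon A i)%N ?addnK //.
rewrite big_mkcond; apply: eq_bigr => i _; rewrite cover_monE.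
by case: (i \in A); rewrite ?muln0 ?muln1.
Qed.

End CoverIdeal.

(** * Circulant graphs *)

Section Arcs.
Local Open Scope nat_scope.
Variable n : nat.
Implicit Types x y z : 'I_n.

(* Clockwise distance on the circle Z/n. *)
Definition cdist x y : nat := if x <= y then y - x else y + n - x.

Lemma cdist_lt x y : cdist x y < n.
Proof. by have := ltn_ord x; have := ltn_ord y; rewrite /cdist; case: ifP; lia. Qed.

Lemma cdistxx x : cdist x x = 0.
Proof. by rewrite /cdist leqnn subnn. Qed.

Lemma cdist0_eq x y : cdist x y = 0 -> x = y.
Proof.
move=> E; apply: val_inj; move: E; have := ltn_ord x.
by rewrite /cdist /=; case: ifP; lia.
Qed.

Lemma cdist_sym x y : x != y -> cdist x y + cdist y x = n.
Proof.
rewrite -(inj_eq val_inj) /=; have := ltn_ord x; have := ltn_ord y.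
by rewrite /cdist; do 2![case: ifP]; lia.
Qed.

Lemma cdist_add x y z :
  cdist x y + cdist y z = cdist x z \/ cdist x y + cdist y z = cdist x z + n.
Proof.
have := ltn_ord x; have := ltn_ord y; have := ltn_ord z.
by rewrite /cdist; do 3![case: ifP]; lia.
Qed.

Lemma cdist_inj x : injective (cdist x).
Proof.
move=> y z E; apply: val_inj; move: E; have := ltn_ord x.
have := ltn_ord y; have := ltn_ord z.
by rewrite /cdist /=; do 2![case: ifP]; lia.
Qed.

Lemma modn_add_ord x d : d < n -> (x + d) %% n = if x + d < n then x + d else x + d - n.
Proof.
move=> dn; case: ltnP => xd; first by rewrite modn_small.
have := ltn_ord x => xn.
by rewrite -[in LHS](subnK xd) modnDr modn_small //; lia.
Qed.

(** Measuring everything from a base point [z] reduces configurations on the circle to linear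
    arithmetic. *)
Lemma cdist_rel z x y :
  (cdist z x <= cdist z y /\ cdist x y = cdist z y - cdist z x) \/
  (cdist z y < cdist z x /\ cdist x y = cdist z y + n - cdist z x).
Proof.
have := cdist_add z x y; have := cdist_lt x y; have := cdist_lt z x.
by have := cdist_lt z y; lia.
Qed.

Lemma neq_cdist z x y : cdist z x <> cdist z y -> x != y.
Proof. by move=> h; apply/eqP => E; apply: h; rewrite E. Qed.

Hypothesis n_gt0 : 0 < n.

Definition vshift x (d : nat) : 'I_n := Ordinal (ltn_pmod (x + d) n_gt0).

Lemma cdist_vshift x d : d < n -> cdist x (vshift x d) = d.
Proof.
move=> dn; rewrite /cdist /vshift /= modn_add_ord //.
by have := ltn_ord x; case: (ltnP (x + d) n); case: ifP; lia.
Qed.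

Lemma vshift_cdist x y : vshift x (cdist x y) = y.
Proof. by apply: (@cdist_inj x); rewrite cdist_vshift // cdist_lt. Qed.

Lemma cdist_vshift2 x d e : d <= e -> e < n -> cdist (vshift x d) (vshift x e) = e - d.
Proof.
move=> de en; have [] := cdist_add x (vshift x d) (vshift x e); rewrite !cdist_vshift //; try lia.
by have := cdist_lt (vshift x d) (vshift x e); lia.
Qed.

Lemma vshiftD x d e : vshift (vshift x d) e = vshift x (d + e).
Proof. by apply: val_inj; rewrite /= modnDml addnA. Qed.

Lemma vshiftDn x d : vshift x (d + n) = vshift x d.
Proof. by apply: val_inj; rewrite /= addnA modnDr. Qed.

Lemma vshift0 x : vshift x 0 = x.
Proof. by apply: val_inj; rewrite /= addn0 modn_small. Qed.

Lemma vshiftK x d : d <= n -> vshift (vshift x d) (n - d) = x.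
Proof. by move=> dn; rewrite vshiftD subnKC //; have := vshiftDn x 0; rewrite add0n vshift0. Qed.

Lemma vshift_eq x y d : d <= n -> (vshift x d == y) = (x == vshift y (n - d)).
Proof.
move=> dn; apply/eqP/eqP => [<-|->]; first by rewrite vshiftK.
by rewrite -{2}(vshiftK y (leq_subr d n)) subKn.
Qed.

Lemma vshift_const (T : Type) (f : 'I_n -> T) :
  (forall v, f (vshift v 1) = f v) -> forall v d, f (vshift v d) = f v.
Proof.
move=> f1 v; elim=> [|d IH]; first by rewrite vshift0.
by rewrite -addn1 -vshiftD f1.
Qed.

(** The covering map onto the circle, used on unrolled sequences. *)
Definition vtx (x : nat) : 'I_n := Ordinal (ltn_pmod x n_gt0).

Lemma vshift_vtx (x d : nat) : vshift (vtx x) d = vtx (x + d).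
Proof. by apply: val_inj; rewrite /= modnDml. Qed.

Lemma cdist_vtx (x y : nat) : x <= y < x + n -> cdist (vtx x) (vtx y) = y - x.
Proof.
move=> xy; have -> : vtx y = vshift (vtx x) (y - x).
  by rewrite vshift_vtx subnKC //; case/andP: xy.
by apply: cdist_vshift; lia.
Qed.

Lemma cdist_vtx_wrap (x y : nat) : x < y < x + n -> cdist (vtx y) (vtx x) = x + n - y.
Proof.
move=> xy; have -> : vtx x = vtx (x + n) by apply: val_inj; rewrite /= modnDr.
by apply: cdist_vtx; lia.
Qed.

Lemma vtx_neq (x y : nat) : x < y < x + n -> (vtx x == vtx y) = false.
Proof.
move=> xy; apply/eqP => E; have := @cdist_vtx x y; rewrite E cdistxx.
by move: xy => /andP[xy ->]; rewrite ltnW // => /(_ isT); lia.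
Qed.

Lemma mem_vtx2 (x y : nat) (v : 'I_n) : x < y < x + n ->
  (v \in [set vtx x; vtx y]) = (x %% n == v) + (y %% n == v) :> nat.
Proof.
move=> /vtx_neq; rewrite !inE -!(inj_eq val_inj) /= ![_ == val v]eq_sym => xy.
by case: (val v =P x %% n) => [->|_]; rewrite ?xy.
Qed.

Lemma mem_vtx3 (x y z : nat) (v : 'I_n) : x < y < z -> z < x + n ->
  (v \in [set vtx x; vtx y; vtx z]) =
    (x %% n == v) + (y %% n == v) + (z %% n == v) :> nat.
Proof.
move=> /andP[xy yz] zx.
have hxy : x < y < x + n by lia.
have /vtx_neq hyz : y < z < y + n by lia.
have /vtx_neq hxz : x < z < x + n by lia.
rewrite -(mem_vtx2 v hxy) in_setU in_set1.
move: hxz hyz; rewrite !inE -!(inj_eq val_inj) /= ![_ == val v]eq_sym => xz yz'.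
by case: (val v =P z %% n) => [->|_]; rewrite ?orbF ?addn0 // ![z %% n == _]eq_sym xz yz'.
Qed.

Lemma sum_vshift (w : 'I_n -> nat) d : d <= n ->
  \sum_v w (vshift v d) = \sum_v w v.
Proof.
move=> dn; rewrite [RHS](reindex (fun v => vshift v d)) //.
exists (fun v => vshift v (n - d)) => v _; first by rewrite vshiftK.
by rewrite -{2}(vshiftK v (leq_subr d n)) subKn.
Qed.

(** Rotations preserve the total weight [W], so summing the relation over all [v] gives
    [W + W = W]. *)
Lemma weight_exchange (w : 'I_n -> nat) d e f : d <= n -> e <= n -> f <= n ->
    (forall v, w (vshift v d) + w (vshift v e) = w (vshift v f)) ->
  forall v, w v = 0.
Proof.
move=> dn en fn E v.
have : \sum_v w v + \sum_v w v = \sum_v w v.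
  rewrite -{1}(sum_vshift w dn) -{1}(sum_vshift w en) -{1}(sum_vshift w fn).
  by rewrite -big_split; apply: eq_bigr.
by rewrite (bigD1 v) //=; lia.
Qed.

End Arcs.

(** * A Freiman criterion for cover ideals, and counting of cyclic multisets *)

Section CountingSums.
Local Open Scope nat_scope.

(** Passing to complements turns uniqueness of combinations of indicators into [combo_inj]: equal
    degrees fix the number of sets involved. *)
Lemma Freiman_cover (k : fieldType) (n d r : nat) (H : sgraph 'I_n)
    (T : 'I_d -> {set 'I_n}) :
    (forall A, max_independent H A <-> exists j, A = T j) ->
    (forall j, #|T j| = r) ->
    (forall b c : 'I_d -> nat,
       (forall v, \sum_(j | v \in T j) b j = \sum_(j | v \in T j) c j) -> b =1 c) ->
  Freiman (cover_ideal k H).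
Proof.
move=> HT Tr T_inj; apply: (@Freiman_free k n d (n - r) (fun j => cover_mon (T j))).
- by move=> j; rewrite mdeg_cover_mon Tr.
- move=> b c; rewrite !mdegE => sum_bc E; apply/mnmP/T_inj => v.
  have split (e : 'X_{1..d}) :
      \sum_(j | v \in T j) e j + combo (fun j => cover_mon (T j)) e v = \sum_j e j.
    rewrite mnm_sumE [RHS](bigID (fun j => v \in T j)) /=; congr addn.
    rewrite big_mkcond [RHS]big_mkcond; apply: eq_bigr => j _ /=.
    by rewrite mulmnE cover_monE; case: (v \in T j); rewrite ?mul1n.
  by apply: (@addIn (combo (fun j => cover_mon (T j)) b v)); rewrite {2}E !split.
move=> f; rewrite cover_idealE; apply/monidealP/monidealP => Hf m /Hf[g].
  move=> /cover_monsP[A /HT[j ->] ->] le.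
  by exists (cover_mon (T j)) => //; exact: (codom_f (fun j => cover_mon (T j))).
move=> /codomP[j ->] le; exists (cover_mon (T j)) => //.
by apply/cover_monsP; exists (T j) => //; apply/HT; exists j.
Qed.

Lemma Freiman_cover_count (k : fieldType) (n r : nat) (H : sgraph 'I_n) :
    (forall A, max_independent H A -> #|A| = r) -> r < n ->
    Freiman (cover_ideal k H) ->
  exists2 l, l <= n &
    size (double_sums (cover_mons H)) + 'C(l, 2) = l * #|max_independent H|.
Proof.
move=> Hr rn F.
have -> : #|max_independent H| = size (cover_mons H) by rewrite size_map -cardE.
have r0 : 0 < n - r by rewrite subn_gt0.
have mdeg_r g : g \in cover_mons H -> mdeg g = n - r.
  by move=> /cover_monsP[A mA ->]; rewrite mdeg_cover_mon Hr.
have le1 g i : g \in cover_mons H -> g i <= 1.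
  by move=> /cover_monsP[A _ ->]; rewrite cover_monE leq_b1.
exact: Freiman_squarefree_sums (@cover_idealE k n H) (uniq_cover_mons H) r0 mdeg_r le1 F.
Qed.

(** Double counting of pairs of a set and one of its points: the codes sent to [A] by [F] project
    onto a set containing [A]. *)
Lemma sum_card_max_independent (n : nat) (H : sgraph 'I_n) (T : finType)
    (F : 'I_n * T -> {set 'I_n}) :
    (forall A a, max_independent H A -> a \in A -> exists t, A = F (a, t)) ->
  \sum_(A | max_independent H A) #|A| <= n * #|T|.
Proof.
move=> HF; rewrite -[n in n * _]card_ord -card_prod.
rewrite -[X in _ <= X]sum1_card (partition_big F predT) //=.
rewrite [X in X <= _]big_mkcond; apply: leq_sum => A _; case: ifP => // mA.
rewrite sum1_card; apply: leq_trans (leq_imset_card fst _).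
apply/subset_leq_card/subsetP => a aA; have [t E] := HF A a mA aA.
have Fat : F (a, t) == A by rewrite E.
by apply/imsetP; exists (a, t).
Qed.

(* A cyclic multiset of residues mod [n], unrolled from one of its points. *)
Definition unrolled n (c : seq nat) : bool :=
  [&& sorted leq c, head 0 c < n & all (fun x => head 0 c <= x <= head 0 c + n) c].

(* The number of entries past [n] locates the starting point, so that an unrolled
   sequence is recovered by sorting its residues. *)
Lemma unrolled_inj n c c' : unrolled n c -> unrolled n c' ->
    perm_eq [seq x %% n | x <- c] [seq x %% n | x <- c'] ->
    count (leq n) c = count (leq n) c' -> c = c'.
Proof.
(* The residues in increasing order: entries past [n] reduce to at most the head, and the others are
   at least the head. *)
pose L c := [seq x - n | x <- c & n <= x] ++ [seq x <- c | ~~ (n <= x)].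
have Lperm e : unrolled n e -> perm_eq (L e) [seq x %% n | x <- e].
  move=> /and3P[_ hn /allP bd].
  apply: perm_trans (perm_map (modn^~ n) (permEl (perm_filterC (leq n) e))).
  rewrite map_cat; apply/permP => P; rewrite /L !count_cat; congr (_ + _); congr count.
    apply/eq_in_map => x; rewrite mem_filter => /andP[nx /bd xb].
    by rewrite -{2}(subnK nx) modnDr modn_small //; lia.
  rewrite -[LHS]map_id; apply/eq_in_map => x; rewrite mem_filter -ltnNge => /andP[xn _].
  by rewrite modn_small.
have Lsorted e : unrolled n e -> sorted leq (L e).
  move=> /and3P[se _ /allP bd].
  rewrite sorted_pairwise; last exact: leq_trans.
  rewrite pairwise_cat -!sorted_pairwise; try exact: leq_trans.
  rewrite !sorted_filter ?andbT; try exact: leq_trans; rewrite ?se //.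
  apply/andP; split.
    apply/allrelP => x y /mapP[x']; rewrite !mem_filter => /andP[_ /bd xb] ->.
    by move=> /andP[_ /bd]; lia.
  apply: (homo_sorted (e := leq)); first by move=> x y; lia.
  by apply: sorted_filter => //; exact: leq_trans.
move=> uc uc' pc cc.
have LE : L c = L c'.
  apply: (sorted_eq leq_trans anti_leq); try exact: Lsorted.
  by rewrite (permPl (Lperm c uc)) perm_sym (permPl (Lperm c' uc')) perm_sym.
(* Equal counts cut the common sorted list at the same place. *)
move/eqP: LE; rewrite /L eqseq_cat ?size_map ?size_filter // => /andP[/eqP E1 /eqP E2].
have {}E1 : [seq x <- c | n <= x] = [seq x <- c' | n <= x].
  have K e : [seq x <- e | n <= x] = [seq x + n | x <- [seq x - n | x <- e & n <= x]].
    rewrite -map_comp -[LHS]map_id; apply/eq_in_map => x.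
    by rewrite mem_filter => /andP[nx _] /=; rewrite subnK.
  by rewrite K E1 -K.
have /and3P[sc _ _] := uc; have /and3P[sc' _ _] := uc'.
apply: (sorted_eq leq_trans anti_leq) => //.
have p e := permEl (perm_filterC (leq n) e).
rewrite -(permPl (p c)); have -> : [seq x <- c | n <= x] ++ filter (predC (leq n)) c =
  [seq x <- c' | n <= x] ++ filter (predC (leq n)) c' by rewrite E1; congr (_ ++ _).
exact: p.
Qed.

(** The value [m t] determines the residues of [c t], and the number of entries past [n] is less
    than [K] because the head is below [n]; so each value has at most [K] codes. *)
Lemma card_unrolled_le n K (M : eqType) (T : finType) (D : {pred T})
    (c : T -> seq nat) (m : T -> M) (L : seq M) :
    0 < K -> {in D, forall t, unrolled n (c t) /\ size (c t) = K} ->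
    {in D &, injective c} -> {in D, forall t, m t \in L} ->
    {in D &, forall t u, m t = m u ->
       perm_eq [seq x %% n | x <- c t] [seq x %% n | x <- c u]} ->
  #|D| <= K * size L.
Proof.
move=> K_gt0 Dc c_inj Dm m_perm.
pose f t := (m t, count (leq n) (c t)).
have f_inj : {in D &, injective f}.
  move=> t u tD uD [mE cE]; apply: c_inj => //.
  by apply: unrolled_inj cE; [case: (Dc t)|case: (Dc u)|exact: m_perm].
have K_gt t : t \in D -> count (leq n) (c t) < K.
  move=> tD; have [/and3P[_ hn _] sK] := Dc t tD.
  case: (c t) hn sK => [|x e] /= hn sK; first by rewrite -sK in K_gt0.
  by rewrite (leqNgt n x) hn add0n -sK ltnS count_size.
rewrite cardE -(size_map f) -(size_iota 0 K) mulnC -(size_allpairs pair).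
apply: uniq_leq_size.
  by rewrite map_inj_in_uniq ?enum_uniq // => t u; rewrite !mem_enum; exact: f_inj.
move=> x /mapP[t]; rewrite mem_enum => tD ->{x}; apply/allpairsP.
by exists (f t); rewrite mem_iota Dm ?K_gt.
Qed.

Lemma cover_pair_perm n (c c' : seq nat) (A B A' B' : {set 'I_n}) : 0 < n ->
    (forall v : 'I_n, count_mem (val v) [seq x %% n | x <- c] = (v \in A) + (v \in B)) ->
    (forall v : 'I_n, count_mem (val v) [seq x %% n | x <- c'] = (v \in A') + (v \in B')) ->
    (cover_mon A + cover_mon B = cover_mon A' + cover_mon B')%MM ->
  perm_eq [seq x %% n | x <- c] [seq x %% n | x <- c'].
Proof.
move=> n_gt0 cA cA' E; apply/allP => x xin.
have xn : x < n.
  by move: xin; rewrite mem_cat => /orP[] /mapP[y _ ->]; rewrite ltn_pmod.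
rewrite /= -[x]/(val (Ordinal xn)) cA cA'; apply/eqP.
move/mnmP/(_ (Ordinal xn)): E; rewrite !mnmDE !cover_monE.
by do 4![case: (_ \in _)].
Qed.

Lemma sum_set2 (T : finType) (w : T -> nat) (a b : T) : a != b ->
  \sum_(i in [set a; b]) w i = w a + w b.
Proof. by move=> ab; rewrite big_setU1 ?inE // big_set1. Qed.

Lemma sum_set3 (T : finType) (w : T -> nat) (a b c : T) : a != b -> b != c -> a != c ->
  \sum_(i in [set a; b; c]) w i = w a + w b + w c.
Proof.
move=> ab bc ac; rewrite -setUA big_setU1 ?inE ?negb_or ?ab //.
by rewrite sum_set2 //= addnA.
Qed.

(* The right-hand side of Freiman's equality is nondecreasing in the analytic
   spread [l] up to [n], because [X <= n m / r] and [r <= m]. *)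
Lemma Freiman_equality_bound r n m w X D l :
    0 < n -> r <= m -> l <= n -> r * X <= n * m -> n * w <= 2 * r * D ->
    D + 'C(l, 2) = l * X ->
  w + r * n.-1 <= 2 * n * m.
Proof.
move=> n0 rm ln Xm wD E.
have E2 : 2 * r * D + r * (l * l.-1) = 2 * l * (r * X).
  by have := bin2_double l; nia.
have h1 : n * w + r * (l * l.-1) <= 2 * l * (n * m).
  by apply: leq_trans (leq_mul (leqnn (2 * l)) Xm); rewrite -E2 leq_add2r.
have h2 : r * (n * n.-1) + 2 * l * (n * m) <= 2 * n * (n * m) + r * (l * l.-1).
  have [e nE] : exists e, n = l + e by exists (n - l); rewrite subnKC.
  have h3 : e * (n * r) <= e * (n * m) by rewrite leq_mul // leq_mul.
  have h4 : n * n.-1 <= 2 * (e * n) + l * l.-1 by clear - nE n0; nia.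
  have h5 : r * (n * n.-1) <= 2 * (e * (n * r)) + r * (l * l.-1).
    by have := leq_mul (leqnn r) h4; clear; lia.
  have -> : 2 * n * (n * m) = 2 * l * (n * m) + 2 * (e * (n * m)).
    by rewrite {1}nE; clear; lia.
  by move: h3 h5; clear; lia.
rewrite -(leq_pmul2l n0) mulnDr; move: h1 h2; clear; lia.
Qed.

(** Distributing the minimum and the maximum leaves six linear inequalities: two are impossible, and
    each of the other four forces extreme gaps. *)
Lemma interleaved_exception s p1 p2 u1 u2 j : 0 < s -> p1 + p2 <= s ->
    u1 + u2 <= s -> j < 3 ->
    minn (s.+1 + p1) (minn (s.+1 + p1 + p2 - u1) (s.*2.+1 - u1 - u2)) <
      maxn (p1 - u1) (p1 + p2 - (u1 + u2)) + j ->
  [\/ [/\ p1 = 0, p2 = s, u1 = 0, u2 = 0 & j = 2],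
      [/\ p1 = 0, p2 = 0, u1 = s, u2 = 0 & j = 2] |
      [/\ p1 = s, p2 = 0, u1 = 0, u2 = s & j = 2]].
Proof.
move=> s0 ps us j3; rewrite addn_maxl leq_max !gtn_min -!orbA => bad.
case/or3P: bad => [h|h|/or4P[h|h|h|h]].
- by exfalso; lia.
- by constructor 2; split; lia.
- by constructor 3; split; lia.
- by constructor 1; split; lia.
- by constructor 2; split; lia.
by exfalso; lia.
Qed.

End CountingSums.

(** * Maximal independent sets of circulant graphs *)

Section Circulant.
Local Open Scope nat_scope.
Variables (k : fieldType) (n s : nat).
Hypotheses (n_gt0 : 0 < n) (s_gt0 : 0 < s) (s_le : s.*2 <= n).
Implicit Types (x y z a b c v : 'I_n) (A B : {set 'I_n}).
Local Notation vshift := (vshift n_gt0).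
Local Notation vtx := (vtx n_gt0).
Local Notation mis := (max_independent (circulant n s)).
Local Notation sums := (double_sums (cover_mons (circulant n s))).

Lemma circulantE x y :
  circulant n s x y = (x != y) && ((cdist x y <= s) || (cdist y x <= s)).
Proof.
rewrite /= /circulant_adj; case: eqP => //= /eqP xy.
have sn : s < n by lia.
have E (u v : 'I_n) d : d < n -> (v == u + d %[mod n]) = (cdist u v == d).
  move=> dn; rewrite [v %% n]modn_small //; apply/eqP/eqP => [vE|<-].
    by rewrite -(cdist_vshift n_gt0 u dn); congr (cdist u _); apply: val_inj; rewrite /= -vE.
  by rewrite -[in LHS](vshift_cdist n_gt0 u v).
have pos (u v : 'I_n) : u != v -> 0 < cdist u v.
  by move=> uv; rewrite lt0n; apply: contraNneq uv => /cdist0_eq->.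
apply/existsP/orP => [[d]|].
  have dn : d.+1 < n by have := ltn_ord d; lia.
  by rewrite !E // => /orP[/eqP->|/eqP->]; [left|right]; exact: ltn_ord d.
have p1 := pos _ _ xy; rewrite eq_sym in xy; have p2 := pos _ _ xy.
case=> le.
  have lt : (cdist x y).-1 < s by lia.
  by exists (Ordinal lt); rewrite /= prednK // E ?cdist_lt ?eqxx.
have lt : (cdist y x).-1 < s by lia.
by exists (Ordinal lt); rewrite /= prednK // (E y x) ?cdist_lt ?eqxx ?orbT.
Qed.

Lemma mis_far A x y : mis A -> x \in A -> y \in A -> x != y -> s < cdist x y.
Proof.
move=> /max_independentP[iA _] xA yA xy.
by have := iA x y xA yA; rewrite circulantE xy /= negb_or -!ltnNge => /andP[].
Qed.

Lemma mis_intro A :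
    {in A &, forall x y, x != y -> s < cdist x y} ->
    (forall v, v \notin A -> exists2 a, a \in A & (cdist v a <= s) || (cdist a v <= s)) ->
  mis A.
Proof.
move=> iA mA; apply/max_independentP; split=> [x y xA yA|v vA].
  rewrite circulantE; case: (eqVneq x y) => //= xy.
  by rewrite negb_or -!ltnNge !iA // eq_sym.
have [a aA va] := mA v vA; exists a => //; rewrite circulantE va andbT.
by apply: contraNneq vA => ->.
Qed.

(** The point at distance [s + 1] after [a] is in [A] or adjacent to some [b] in [A]; as [b] is not
    within [s] of [a], it lies at most [s] further on. *)
Lemma mis_next A a : s.*2.+2 <= n -> mis A -> a \in A ->
  exists2 b, b \in A & s < cdist a b <= s.*2.+1.
Proof.
move=> n_ge mA aA; pose v := vshift a s.+1.
have av : cdist a v = s.+1 by apply: cdist_vshift; lia.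
case: (boolP (v \in A)) => vA; first by exists v; rewrite ?av; lia.
have /max_independentP[_ /(_ v vA)[b bA]] := mA.
rewrite circulantE => /andP[vb le]; exists b => //.
have va : a != v by apply: contraTneq aA => ->.
have vav := cdist_sym va.
have ab : a != b.
  apply/eqP => E; move: le; rewrite -E av; lia.
have far := mis_far mA aA bA ab; rewrite eq_sym in ab; have farb := mis_far mA bA aA ab.
rewrite eq_sym in ab; have := cdist_sym ab; have := cdist_sym vb.
by have := cdist_add a v b; have := cdist_add a b v; have := cdist_lt a b; lia.
Qed.

(** A third point between [a] and [b] would need a gap of at least [2 * s + 2]. *)
Lemma mis_gap A a b c : mis A -> a \in A -> b \in A -> c \in A ->
  cdist a b <= s.*2.+1 -> c != a -> c != b -> cdist a b < cdist a c.
Proof.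
move=> mA aA bA cA ab ca cb; have far1 := mis_far mA cA bA cb.
rewrite eq_sym in ca; have far2 := mis_far mA aA cA ca.
by have := cdist_add a c b; have := cdist_lt a b; have := cdist_lt c b; lia.
Qed.

(** Gaps longer than [s] give independence; a point in a gap of length at most [2 * s + 1] is within
    [s] of an end, which gives maximality. *)
Lemma mis_pair a b :
    s < cdist a b <= s.*2.+1 -> s < cdist b a <= s.*2.+1 -> mis [set a; b].
Proof.
move=> ab ba; have ab' : a != b by apply: contraTneq ab => ->; rewrite cdistxx.
apply: mis_intro => [x y|v].
  by rewrite !inE => /orP[] /eqP-> /orP[] /eqP->; rewrite ?eqxx //; lia.
rewrite !inE negb_or => /andP[va vb].
have [h|h] := leqP (cdist a v) s; first by exists a; rewrite ?inE ?eqxx ?h ?orbT.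
have [h'|h'] := leqP (cdist v a) s; first by exists a; rewrite ?inE ?eqxx ?h'.
exists b; rewrite ?inE ?eqxx ?orbT //.
have := cdist_sym va; have := cdist_sym vb; have := cdist_sym ab'.
have := cdist_add a v b; have := cdist_lt v b; have := cdist_lt a b.
lia.
Qed.

Lemma mis_triple a b c : s < cdist a b <= s.*2.+1 -> s < cdist b c <= s.*2.+1 ->
  s < cdist c a <= s.*2.+1 -> cdist a b + cdist b c + cdist c a = n -> mis [set a; b; c].
Proof.
move=> ab bc ca sum.
have ab' : a != b by apply: contraTneq ab => ->; rewrite cdistxx.
have bc' : b != c by apply: contraTneq bc => ->; rewrite cdistxx.
have ca' : c != a by apply: contraTneq ca => ->; rewrite cdistxx.
have := cdist_sym ab'; have := cdist_sym bc'; have := cdist_sym ca' => Ea Eb Ec.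
apply: mis_intro => [x y|v].
  by rewrite !inE -!orbA => /or3P[] /eqP-> /or3P[] /eqP->; rewrite ?eqxx //; lia.
rewrite !inE !negb_or -!andbA => /and3P[va vb vc].
have [h|h] := leqP (cdist a v) s; first by exists a; rewrite ?inE ?eqxx ?h ?orbT.
have [h'|h'] := leqP (cdist v a) s; first by exists a; rewrite ?inE ?eqxx ?h'.
have [g|g] := leqP (cdist b v) s; first by exists b; rewrite ?inE ?eqxx ?g ?orbT.
have [g'|g'] := leqP (cdist v b) s; first by exists b; rewrite ?inE ?eqxx ?g' ?orbT.
exists c; rewrite ?inE ?eqxx ?orbT //.
have := cdist_sym va; have := cdist_sym vb; have := cdist_sym vc.
have := cdist_add a v b; have := cdist_add a b v; have := cdist_add b v c.
have := cdist_lt v b; have := cdist_lt a b; have := cdist_lt v c; have := cdist_lt b c.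
lia.
Qed.

(** Three gaps would already need [3 * s + 3] points. *)
Lemma mis_pairP A a : s.*2.+2 <= n <= 3 * s + 2 -> mis A -> a \in A ->
  exists2 p, p < n - s.*2.+1 & A = [set a; vshift a (s.+1 + p)].
Proof.
move=> /andP[n_ge n_le] mA aA; have [b bA ab] := mis_next n_ge mA aA.
have ab' : a != b by apply: contraTneq ab => ->; rewrite cdistxx.
have sym := cdist_sym ab'; have far : s < cdist b a by apply: mis_far mA bA aA _; rewrite eq_sym.
exists (cdist a b - s.+1); first by lia.
rewrite subnKC ?vshift_cdist; last by lia.
apply/setP => c; rewrite !inE; apply/idP/orP => [cA|[] /eqP-> //].
apply/orP; apply: contraT; rewrite negb_or => /andP[ca cb].
have ba' : b != a by rewrite eq_sym.
have h1 : cdist a b < cdist a c by apply: mis_gap mA aA bA cA _ _ _ => //; lia.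
have h2 : cdist b a < cdist b c by apply: mis_gap mA bA aA cA _ _ _ => //; lia.
by have := cdist_add a b c; have := cdist_lt a c; have := cdist_lt b c; lia.
Qed.

(** Two gaps cover at most [4 * s + 2] points and four need [4 * s + 4], so there are exactly
    three. *)
Lemma mis_tripleP A a : n = 4 * s + 3 -> mis A -> a \in A ->
  exists p1 p2, p1 + p2 <= s /\
    A = [set a; vshift a (s.+1 + p1); vshift a (s.*2.+2 + p1 + p2)].
Proof.
move=> nE mA aA; have n_ge : s.*2.+2 <= n by lia.
have [b bA ab] := mis_next n_ge mA aA.
have [c cA bc] := mis_next n_ge mA bA.
have ac : cdist a c = cdist a b + cdist b c by have := cdist_add a b c; lia.
have ab' : a != b by apply: contraTneq ab => ->; rewrite cdistxx.
have ca' : c != a by apply/eqP => E; move: ac; rewrite E cdistxx; lia.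
have cb' : c != b by apply/eqP => E; move: bc; rewrite E cdistxx; lia.
have sym := cdist_sym ca'; have far := mis_far mA cA aA ca'.
exists (cdist a b - s.+1), (cdist b c - s.+1); split; first by lia.
have -> : s.+1 + (cdist a b - s.+1) = cdist a b by lia.
have -> : s.*2.+2 + (cdist a b - s.+1) + (cdist b c - s.+1) = cdist a c by lia.
rewrite !vshift_cdist; apply/setP => d; rewrite !inE -orbA.
apply/idP/or3P => [dA|[] /eqP-> //]; apply/or3P; apply: contraT.
rewrite !negb_or => /and3P[da db dc].
have h1 : cdist a b < cdist a d by apply: mis_gap mA aA bA dA _ _ _ => //; lia.
have h2 : cdist b c < cdist b d by apply: mis_gap mA bA cA dA _ _ _ => //; lia.
have h3 : cdist c a < cdist c d by apply: mis_gap mA cA aA dA _ _ _ => //; lia.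
have e1 : cdist a d = cdist a b + cdist b d.
  by move: h1 (cdist_add a b d) (cdist_lt b d); clear; lia.
have e2 : cdist b d = cdist b c + cdist c d.
  by move: h2 (cdist_add b c d) (cdist_lt c d); clear; lia.
by move: h3 e1 e2 ac sym (cdist_lt a d); clear; lia.
Qed.

Lemma mis_neq0 A : mis A -> exists a, a \in A.
Proof.
move=> /max_independentP[_ /(_ (Ordinal n_gt0))]; case: (boolP (Ordinal n_gt0 \in A)).
  by move=> aA _; exists (Ordinal n_gt0).
by move=> _ /(_ isT)[a aA _]; exists a.
Qed.

(** * Circulant graphs whose cover ideal is Freiman *)

Lemma mis_complete : n <= s.*2.+1 -> forall A, mis A <-> exists v, A = [set v].
Proof.
move=> n_le A; split=> [mA|[v ->]].
  have [v vA] := mis_neq0 mA; exists v; apply/eqP.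
  rewrite eqEsubset sub1set vA andbT; apply/subsetP => w wA; rewrite inE.
  apply: contraT => wv; have f1 := mis_far mA wA vA wv.
  have := cdist_sym wv; rewrite eq_sym in wv.
  by have f2 := mis_far mA vA wA wv; lia.
apply: mis_intro => // [x y|w].
  by rewrite !inE => /eqP-> /eqP->; rewrite eqxx.
by rewrite inE => wv; exists v; rewrite ?inE //; have := cdist_sym wv; lia.
Qed.

Lemma Freiman_complete : n <= s.*2.+1 -> Freiman (cover_ideal k (circulant n s)).
Proof.
move=> n_le; apply: (@Freiman_cover k n n 1 _ (fun v => [set v])).
- exact: mis_complete.
- by move=> v; rewrite cards1.
move=> b c E v; have := E v.
by rewrite !(eq_bigl (pred1 v)) ?big_pred1_eq // => j; rewrite inE eq_sym.
Qed.

(** The maximal independent sets are the antipodal pairs; they partition the vertices, so each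
    coefficient is read off at one vertex. *)
Lemma Freiman_cocktail : n = s.*2.+2 -> Freiman (cover_ideal k (circulant n s)).
Proof.
move=> nE; have le : s.+1 <= n by lia.
pose T (j : 'I_s.+1) : {set 'I_n} :=
  [set widen_ord le j; vshift (widen_ord le j) s.+1].
have memT (j : 'I_s.+1) v : (v \in T j) = (val v == j) || (val v == j + s.+1).
  rewrite !inE -!(inj_eq val_inj) /= modn_small //.
  by have := ltn_ord j; lia.
apply: (@Freiman_cover k n s.+1 2 _ T).
- move=> A; split=> [mA|[j ->]]; last first.
    have ar : cdist (widen_ord le j) (vshift (widen_ord le j) s.+1) = s.+1.
      by apply: cdist_vshift; lia.
    have neq : widen_ord le j != vshift (widen_ord le j) s.+1.
      by apply/eqP => E; move: ar; rewrite -E cdistxx.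
    by apply: mis_pair => //; have := cdist_sym neq; lia.
  have [a aA] := mis_neq0 mA.
  have [|p p1 AE] := mis_pairP _ mA aA; first by lia.
  have p0 : p = 0 by lia.
  rewrite AE p0 addn0; case: (ltnP a s.+1) => ha.
    exists (Ordinal ha); apply/setP => v; rewrite memT !inE -!(inj_eq val_inj) /=.
    by rewrite modn_small //; lia.
  have ha' : a - s.+1 < s.+1 by have := ltn_ord a; lia.
  exists (Ordinal ha'); apply/setP => v; rewrite memT !inE -!(inj_eq val_inj) /=.
  have -> : (a + s.+1) %% n = a - s.+1.
    rewrite modn_add_ord; last by lia.
    by have := ltn_ord a; case: ifP; lia.
  by rewrite subnK // orbC.
- move=> j; rewrite cards2; case: eqP => // E.
  have := congr1 val E; rewrite /= modn_small; by have := ltn_ord j; lia.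
move=> b c E j; have := E (widen_ord le j).
rewrite !(eq_bigl (pred1 j)) ?big_pred1_eq // => i; rewrite memT /= -(inj_eq val_inj) /=;
  by have := ltn_ord j; lia.
Qed.

(** The maximal independent sets are the edges of an odd cycle, whose incidence matrix is invertible
    over the rationals. *)
Lemma Freiman_odd_cycle_complement :
  n = s.*2.+3 -> Freiman (cover_ideal k (circulant n s)).
Proof.
move=> nE; pose T v := [set v; vshift v s.+1].
have neq v : v != vshift v s.+1.
  apply/eqP => E; have := cdist_vshift n_gt0 v (d := s.+1); rewrite -E cdistxx; lia.
apply: (@Freiman_cover k n n 2 _ T).
- move=> A; split=> [mA|[v ->]]; last first.
    have ar : cdist v (vshift v s.+1) = s.+1 by apply: cdist_vshift; lia.
    by apply: mis_pair => //; have := cdist_sym (neq v); lia.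
  have [a aA] := mis_neq0 mA.
  have [|p p1 AE] := mis_pairP _ mA aA; first by lia.
  have [p0|p0] : p = 0 \/ p = 1 by lia.
    by exists a; rewrite AE p0 addn0.
  exists (vshift a s.+2); rewrite AE p0 /T vshiftD setUC addn1.
  by rewrite (_ : s.+2 + s.+1 = 0 + n) ?vshiftDn ?vshift0 //; lia.
- by move=> v; rewrite cards2 neq.
move=> b c E.
have sumT (e : 'I_n -> nat) v : \sum_(j | v \in T j) e j = e v + e (vshift v s.+2).
  have neq' : vshift v s.+2 != v.
    rewrite eq_sym; apply/eqP => F; have := cdist_vshift n_gt0 v (d := s.+2).
    by rewrite -F cdistxx; lia.
  rewrite (bigD1 v) ?inE ?eqxx //= (bigD1 (vshift v s.+2)) /=.
    rewrite big1 ?addn0 // => j; rewrite !inE => /andP[/andP[]].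
    rewrite [_ == vshift j _]eq_sym vshift_eq; last by lia.
    have -> : n - s.+1 = s.+2 by lia.
    by rewrite eq_sym; case: eqP => //= _ ->.
  rewrite !inE neq' andbT; apply/orP; right; rewrite eq_sym vshift_eq; last by lia.
  by have -> : n - s.+1 = s.+2 by lia.
(* The difference of two solutions changes sign under the shift by [s + 2]; twice that shift is the
   shift by 1 modulo [n], so [f] is constant and equal to its opposite. *)
pose f v : int := (Posz (b v) - Posz (c v))%R.
have f2 v : f (vshift v s.+2) = (- f v)%R.
  by have := E v; rewrite !sumT /f; lia.
have f1 v : f (vshift v 1) = f v.
  have := f2 (vshift v s.+2); rewrite (f2 v) opprK vshiftD => <-.
  by rewrite (_ : s.+2 + s.+2 = 1 + n) ?vshiftDn //; lia.
by move=> v; have := f2 v; rewrite (vshift_const f1) /f; lia.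
Qed.

Lemma Freiman_heptagon : n = 7 -> s = 1 -> Freiman (cover_ideal k (circulant n s)).
Proof.
move=> n7 s1; pose T v := [set v; vshift v 2; vshift v 4].
have vshift7 v d : vshift v (d + 7) = vshift v d by rewrite -n7 vshiftDn.
have neq_vshift v d : 0 < d < 7 -> (v == vshift v d) = false.
  move=> d7; apply/eqP => F; have := cdist_vshift n_gt0 v (d := d).
  by rewrite -F cdistxx; lia.
have neq_vshift2 v d e : d < e < 7 -> (vshift v d == vshift v e) = false.
  move=> de; have -> : e = d + (e - d) by lia.
  by rewrite -vshiftD neq_vshift; lia.
apply: (@Freiman_cover k n n 3 _ T).
- move=> A; split=> [mA|[v ->]]; last first.
    have a1 : cdist v (vshift v 2) = 2 by apply: cdist_vshift; lia.
    have a2 : cdist (vshift v 2) (vshift v 4) = 2 by apply: cdist_vshift2; lia.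
    have a3 : cdist (vshift v 4) v = 3.
      have v4 : v != vshift v 4 by rewrite neq_vshift.
      by have := cdist_sym v4; rewrite cdist_vshift; lia.
    by apply: mis_triple; lia.
  have [a aA] := mis_neq0 mA.
  have [|p1 [p2 [p12 AE]]] := mis_tripleP _ mA aA; first by lia.
  (* Exactly one gap is 3 and the others are 2; the cases only locate it, so every triple is a
     rotation of the same one. *)
  have : [\/ p1 = 0 /\ p2 = 0, p1 = 1 /\ p2 = 0 | p1 = 0 /\ p2 = 1].
    case: p1 p12 {AE} => [|[|?]]; case: p2 => [|[|?]]; rewrite s1 //.
    - by constructor 1.
    - by constructor 3.
    by constructor 2.
  case=> -[E1 E2]; move: AE; rewrite E1 E2 s1 => ->.
  + by exists a.
  + exists (vshift a 3); rewrite /T !vshiftD; apply/setP => v.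
    by rewrite -[3 + 4]/(0 + 7) vshift7 vshift0 !inE; do 3![case: (_ == _)].
  exists (vshift a 5); rewrite /T !vshiftD; apply/setP => v.
  rewrite -[5 + 4]/(2 + 7) -[5 + 2]/(0 + 7) !vshift7 vshift0 !inE.
  by do 3![case: (_ == _)].
- move=> v; rewrite /T setUC cardsU1 cards2 !inE neq_vshift //.
  by rewrite eq_sym neq_vshift // eq_sym neq_vshift2.
move=> b c E.
have sumT (e : 'I_n -> nat) v :
    \sum_(j | v \in T j) e j = e v + e (vshift v 5) + e (vshift v 3).
  have memT j : (v \in T j) = [|| j == v, j == vshift v 5 | j == vshift v 3].
    have [e2 e4] : n - 2 = 5 /\ n - 4 = 3 by rewrite n7.
    rewrite !inE -orbA ![v == _]eq_sym [vshift j 2 == _]vshift_eq; last by lia.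
    by rewrite [vshift j 4 == _]vshift_eq ?e2 ?e4 //; lia.
  rewrite (eq_bigl _ _ memT) (bigD1 v) ?eqxx //= (bigD1 (vshift v 5)) /=; last first.
    by rewrite eqxx orbT /= eq_sym neq_vshift.
  rewrite (bigD1 (vshift v 3)) /=; last first.
    by rewrite eqxx !orbT /= eq_sym neq_vshift // neq_vshift2.
  rewrite big1 ?addn0 ?addnA // => j.
  by rewrite -!andbA => /and4P[+ /negPf h1 /negPf h2 /negPf h3]; rewrite h1 h2 h3.
(* Subtracting the relations at [v] and [v + 5] gives [f (v + 1) = f v], after which
   [3 * f v = 0]. *)
pose f v : int := (Posz (b v) - Posz (c v))%R.
have f0 v : (f v + f (vshift v 5) + f (vshift v 3) = 0)%R.
  by have := E v; rewrite !sumT /f; lia.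
have f1 v : f (vshift v 1) = f v.
  have := f0 v; have := f0 (vshift v 5); rewrite !vshiftD.
  rewrite -[5 + 5]/(3 + 7) -[5 + 3]/(1 + 7) !vshift7; lia.
by move=> v; have := f0 v; rewrite !(vshift_const f1) /f; lia.
Qed.

(** * Cover ideals that are not quasi-equigenerated *)

Lemma not_quasi_equigenerated_between : 3 * s + 3 <= n <= 4 * s + 2 ->
  ~ quasi_equigenerated (cover_ideal k (circulant n s)).
Proof.
move=> n_int /quasi_equigenerated_cover[w w0 [d wd]].
have /(_ (Ordinal n_gt0)) : forall v, w v = 0.
  apply: (@weight_exchange n n_gt0 w s.+1 s.*2.+2 (n - s.*2.+1)); try lia.
  (* The gaps of [v, a, b] are [s + 1], [s + 1], [n - 2s - 2], and those of [v, c] are [n - 2s - 1],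
     [2s + 1]; both sets are maximal, so [a] and [b] together weigh as much as [c]. *)
  move=> v; set a := vshift v s.+1; set b := vshift v s.*2.+2; set c := vshift v _.
  have da : cdist v a = s.+1 by apply: cdist_vshift; lia.
  have db : cdist v b = s.*2.+2 by apply: cdist_vshift; lia.
  have dc : cdist v c = n - s.*2.+1 by apply: cdist_vshift; lia.
  have dv := cdistxx v.
  have va : v != a by apply: (@neq_cdist n v); lia.
  have vb : v != b by apply: (@neq_cdist n v); lia.
  have vc : v != c by apply: (@neq_cdist n v); lia.
  have ab : a != b by apply: (@neq_cdist n v); lia.
  have m3 : mis [set v; a; b].
    have := cdist_rel v a b; have := cdist_rel v b v.
    by rewrite da db dv => h1 h2; apply: mis_triple; rewrite ?da; lia.
  have m2 : mis [set v; c].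
    have := cdist_rel v c v.
    by rewrite dc dv => h; apply: mis_pair; rewrite ?dc; lia.
  have := wd _ m3; rewrite sum_set3 // => E3.
  by have := wd _ m2; rewrite sum_set2 // => E2; lia.
by have := w0 (Ordinal n_gt0); lia.
Qed.

(* Any maximal independent set through v, v + (s+1), v + 2(s+1), v + 3(s+1) stays
   maximal when its two middle vertices are replaced by v + (s+2). *)
Lemma mis_exchange v : 4 * s + 4 <= n -> exists A,
  [/\ mis A, vshift v s.+1 \in A, vshift v s.*2.+2 \in A,
      vshift v s.+2 \notin A &
      mis (vshift v s.+2 |: (A :\ vshift v s.+1) :\ vshift v s.*2.+2)].
Proof.
move=> n_ge; set a := vshift v s.+1; set b := vshift v s.*2.+2.
set c := vshift v (3 * s + 3); set u := vshift v s.+2.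
have da : cdist v a = s.+1 by apply: cdist_vshift; lia.
have db : cdist v b = s.*2.+2 by apply: cdist_vshift; lia.
have dc : cdist v c = 3 * s + 3 by apply: cdist_vshift; lia.
have du : cdist v u = s.+2 by apply: cdist_vshift; lia.
have dv := cdistxx v.
have [va vb ca cb] : [/\ v != a, v != b, c != a & c != b].
  by split; apply: (@neq_cdist n v); rewrite ?da ?db ?dc ?dv; clear - s_gt0; lia.
have [|A mA sA] := @ex_max_independent n (circulant n s) [set v; a; b; c].
  apply/independentP => x y xS yS; rewrite circulantE; apply/negP => /andP[xy].
  have := cdist_rel v x y; have := cdist_rel v y x; move: xS yS xy.
  rewrite !inE -!orbA => /or4P[] /eqP-> /or4P[] /eqP->; rewrite ?eqxx //;
    rewrite ?da ?db ?dc ?dv; clear - n_ge s_gt0; lia.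
have [vA aA bA cA] : [/\ v \in A, a \in A, b \in A & c \in A].
  by split; apply: (subsetP sA); rewrite !inE eqxx ?orbT.
(* The remaining points of [A] all lie beyond [c], hence far from [u]. *)
have outA y : y \in A -> y != v -> y != a -> y != b -> y != c ->
    3 * s + 3 + s < cdist v y /\ cdist v y + s < n.
  move=> yA yv ya yb yc.
  have yn := cdist_lt v y.
  have step z : z \in A -> y != z -> cdist v z <= cdist v y ->
      cdist v z + s < cdist v y /\ cdist v y + s < cdist v z + n.
    move=> zA yz; have f := mis_far mA yA zA yz; rewrite eq_sym in yz.
    have := mis_far mA zA yA yz; move: f (cdist_rel v y z) (cdist_rel v z y) yn.
    by have := cdist_lt v z; clear; lia.
  have := step v vA yv; rewrite dv => -[] // h0 h0'.
  have := step a aA ya; rewrite da => -[|h1 _]; first by clear - h0; lia.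
  have := step b bA yb; rewrite db => -[|h2 _]; first by clear - h1; lia.
  have := step c cA yc; rewrite dc => -[|h3 _]; first by clear - h2; lia.
  by split; [clear - h3 | clear - h0']; lia.
have uA : u \notin A.
  apply/negP => uA; have := outA u uA; rewrite du.
  by case; try apply: (@neq_cdist n v); rewrite ?du ?dv ?da ?db ?dc; clear - s_gt0; lia.
exists A; split=> //; apply: mis_intro.
  have far_u y : y \in A -> y != a -> y != b -> s < cdist u y /\ s < cdist y u.
    move=> yA ya yb; have := cdist_rel v u y; have := cdist_rel v y u; rewrite du.
    case: (eqVneq y v) => [->|yv]; first by rewrite dv; clear - n_ge; lia.
    case: (eqVneq y c) => [->|yc]; first by rewrite dc; clear - n_ge; lia.
    by have [] := outA y yA yv ya yb yc; clear - n_ge; lia.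
  move=> x y; rewrite !inE => /orP[/eqP->|/and3P[xb xa xA]] /orP[/eqP->|/and3P[yb ya yA]].
  - by rewrite eqxx.
  - by case: (far_u y yA ya yb).
  - by case: (far_u x xA xa xb).
  exact: mis_far mA xA yA.
move=> x; rewrite !inE negb_or => /andP[xu xA'].
have vA' : v \in u |: (A :\ a) :\ b.
  by rewrite !inE vA va vb orbT.
have cA' : c \in u |: (A :\ a) :\ b.
  by rewrite !inE cA ca cb orbT.
have uA' : u \in u |: (A :\ a) :\ b by rewrite !inE eqxx.
have xn := cdist_lt v x.
(* Going round from [v], successive arcs are dominated by [v], by [u] and by [c]; beyond [c], a
   neighbour of [x] in [A] is neither [a] nor [b], so it survives the exchange. *)
case: (leqP (cdist v x) s) => x1; first by exists v; rewrite ?x1 ?orbT.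
case: (leqP (cdist v x) s.*2.+2) => x2.
  exists u => //; have := cdist_rel v u x; have := cdist_rel v x u; rewrite du.
  by clear - x1 x2 xn s_gt0; lia.
case: (leqP (cdist v x) (3 * s + 3)) => x3.
  exists c => //; have := cdist_rel v c x; have := cdist_rel v x c; rewrite dc.
  by clear - x2 x3 xn; lia.
have xa : x != a by apply: (@neq_cdist n v); rewrite da; clear - x3; lia.
have xb : x != b by apply: (@neq_cdist n v); rewrite db; clear - x2; lia.
move: xA'; rewrite xa xb /= => xA.
have /max_independentP[_ /(_ x xA)[y yA]] := mA.
rewrite circulantE => /andP[xy near].
exists y; last by [].
rewrite !inE yA andbT; apply/orP; right.
apply/andP; split; apply/eqP => E; move: near; rewrite E.
  by have := cdist_rel v b x; have := cdist_rel v x b; rewrite db; clear - x3 xn; lia.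
by have := cdist_rel v a x; have := cdist_rel v x a; rewrite da; clear - x3 xn; lia.
Qed.

Lemma not_quasi_equigenerated_large : 4 * s + 4 <= n ->
  ~ quasi_equigenerated (cover_ideal k (circulant n s)).
Proof.
move=> n_ge /quasi_equigenerated_cover[w w0 [d wd]].
have /(_ (Ordinal n_gt0)) : forall v, w v = 0.
  apply: (@weight_exchange n n_gt0 w s.+1 s.*2.+2 s.+2); try lia.
  move=> v; have [A [mA aA bA uA mA']] := mis_exchange v n_ge.
  have := wd _ mA'; rewrite -(wd _ mA) big_setU1 /=; last first.
    by rewrite !inE (negPf uA) !andbF.
  rewrite (big_setD1 _ aA) (big_setD1 (vshift v s.*2.+2)) /=.
    by rewrite addnA => /addIn->.
  rewrite !inE bA andbT; apply: (@neq_cdist n v).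
  by rewrite !cdist_vshift; lia.
by have := w0 (Ordinal n_gt0); lia.
Qed.

Lemma mem_double_sums A B : mis A -> mis B ->
  (cover_mon A + cover_mon B)%MM \in sums.
Proof.
move=> mA mB; rewrite mem_undup; apply/allpairsP.
by exists (cover_mon A, cover_mon B); split=> //; apply/cover_monsP; [exists A|exists B].
Qed.

Lemma mis_vtx2 (x y : nat) : s < y - x -> y - x + s < n -> y - x <= s.*2.+1 ->
  n <= y - x + s.*2.+1 -> mis [set vtx x; vtx y].
Proof.
move=> h1 h2 h3 h4; apply: mis_pair; first by rewrite cdist_vtx; lia.
by rewrite cdist_vtx_wrap; lia.
Qed.

(** * The range 2s + 4 <= n <= 3s + 2, where maximal independent sets are pairs *)

Section Pairs.
Hypothesis n_int : s.*2.+4 <= n <= 3 * s + 2.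
Local Notation d := (n - s.*2.+1).

Lemma mis_pair_card A : mis A -> #|A| = 2.
Proof.
move=> mA; have [a aA] := mis_neq0 mA.
have [|p pd ->] := mis_pairP _ mA aA; first by lia.
rewrite cards2; case: eqP => // E.
by have := @cdist_vshift n n_gt0 a (s.+1 + p); rewrite -E cdistxx; lia.
Qed.

(** A pair is coded from either of its points by one of [d] clockwise distances. *)
Lemma card_mis_pairs : 2 * #|mis| <= n * d.
Proof.
rewrite -[d]card_ord mulnC -sum_nat_const.
rewrite -(eq_bigr _ mis_pair_card).
apply: (@sum_card_max_independent _ _ _
  (fun t : 'I_n * 'I_d => [set t.1; vshift t.1 (s.+1 + t.2)])).
move=> A a mA aA; have [|p pd ->] := mis_pairP _ mA aA; first by lia.
by exists (Ordinal pd).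
Qed.

(* The chords [{c1, c3}] and [{c2, c4}] have lengths s + 1 + p and s + 1 + q; they
   interleave when c3 - c2 lies between P + Q - n (truncated at 0) and min(P, Q),
   an interval with at least s + 2 points. *)
Definition pair_gap1 (t : 'I_n * ('I_d * 'I_d * 'I_s.+2)) := s.+1 + t.2.1.1.
Definition pair_gap2 (t : 'I_n * ('I_d * 'I_d * 'I_s.+2)) := s.+1 + t.2.1.2.

Definition pair_seq (t : 'I_n * ('I_d * 'I_d * 'I_s.+2)) : seq nat :=
  let c2 := t.1 + pair_gap1 t - (pair_gap1 t + pair_gap2 t - n + t.2.2) in
  [:: t.1 : nat; c2; t.1 + pair_gap1 t; c2 + pair_gap2 t].

(** Entries alternate between the two chords, and four entries mean at most four codes for each
    sum. *)
Lemma double_sums_pairs : n * (d * d * s.+2) <= 4 * size sums.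
Proof.
have -> : n * (d * d * s.+2) = #|{: 'I_n * ('I_d * 'I_d * 'I_s.+2)}|.
  by rewrite !card_prod !card_ord.
pose S t := [set vtx (nth 0 (pair_seq t) 0); vtx (nth 0 (pair_seq t) 2)].
pose S' t := [set vtx (nth 0 (pair_seq t) 1); vtx (nth 0 (pair_seq t) 3)].
apply: (@card_unrolled_le n 4 _ _ _ pair_seq
  (fun t => (cover_mon (S t) + cover_mon (S' t))%MM)) => //.
- move=> [a [[p q] j]] _; split=> //; rewrite /unrolled /pair_seq /pair_gap1 /pair_gap2 /=.
  by have := ltn_ord a; have := ltn_ord p; have := ltn_ord q; have := ltn_ord j; lia.
- move=> [a [[p q] j]] [a' [[p' q'] j']] _ _; rewrite /pair_seq /pair_gap1 /pair_gap2 /=.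
  have := ltn_ord a; have := ltn_ord p; have := ltn_ord q; have := ltn_ord j.
  have := ltn_ord a'; have := ltn_ord p'; have := ltn_ord q'; have := ltn_ord j'.
  move=> j'n q'n p'n a'n jn qn pn an [E1 E2 E3 E4].
  have Ea : a = a' by apply: val_inj.
  have Ep : p = p' by apply: val_inj => /=; lia.
  have Eq : q = q' by apply: val_inj => /=; lia.
  by rewrite Ea Ep Eq; congr (_, (_, _, _)); apply: val_inj => /=; rewrite -Ep -Eq in E2; lia.
- move=> [a [[p q] j]] _; rewrite /S /S' /pair_seq /pair_gap1 /pair_gap2 /=.
  have := ltn_ord a; have := ltn_ord p; have := ltn_ord q; have := ltn_ord j => *.
  by apply: mem_double_sums; apply: mis_vtx2; lia.
have count_seq t v : count_mem (val v) [seq i %% n | i <- pair_seq t] =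
    (v \in S t) + (v \in S' t).
  case: t => [a [[p q] j]]; rewrite /S /S' /pair_seq /pair_gap1 /pair_gap2 /=.
  have := ltn_ord a; have := ltn_ord p; have := ltn_ord q; have := ltn_ord j => *.
  by rewrite !mem_vtx2; lia.
by move=> t u _ _; apply: (cover_pair_perm n_gt0).
Qed.

End Pairs.

Lemma not_Freiman_pairs : s.*2.+4 <= n <= 3 * s + 2 ->
  ~ Freiman (cover_ideal k (circulant n s)).
Proof.
move=> n_int F; have n2 : 2 < n by lia.
have [l ln E] := Freiman_cover_count (mis_pair_card n_int) n2 F.
have d2 : 2 <= n - s.*2.+1 by lia.
have := Freiman_equality_bound n_gt0 d2 ln (card_mis_pairs n_int)
  (double_sums_pairs n_int) E.
have [d [nE d3]] : exists d, n = d + s.*2.+1 /\ 3 <= d.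
  by exists (n - s.*2.+1); lia.
(* The inequality simplifies to [s * (d - 2) ^ 2 <= 0], false since [3 <= d]. *)
by rewrite nE addnK; clear - d3 s_gt0; nia.
Qed.

Lemma mis_vtx3 (x y z : nat) : s < y - x <= s.*2.+1 -> s < z - y <= s.*2.+1 ->
  s < x + n - z <= s.*2.+1 -> mis [set vtx x; vtx y; vtx z].
Proof.
move=> h1 h2 h3.
have xy : cdist (vtx x) (vtx y) = y - x by apply: cdist_vtx; lia.
have yz : cdist (vtx y) (vtx z) = z - y by apply: cdist_vtx; lia.
have zx : cdist (vtx z) (vtx x) = x + n - z by apply: cdist_vtx_wrap; lia.
by apply: mis_triple; rewrite ?xy ?yz ?zx //; lia.
Qed.

(** * The case n = 4s + 3, where maximal independent sets are triples *)

Section Triples.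
Hypothesis nE : n = 4 * s + 3.

Lemma mis_triple_card A : mis A -> #|A| = 3.
Proof.
move=> mA; have [a aA] := mis_neq0 mA.
have [p1 [p2 [p12 ->]]] := mis_tripleP nE mA aA.
rewrite -setUA cardsU1 cards2 !inE negb_or.
rewrite !(@neq_cdist n a) ?cdistxx ?cdist_vshift //; lia.
Qed.

(* [(p1, p2)] encodes the gaps [s + 1 + p1], [s + 1 + p2], [s + 1 + (s - p1 - p2)]
   of a triple. *)
Definition gaps : {set 'I_s.+1 * 'I_s.+1} := [set p : 'I_s.+1 * 'I_s.+1 | p.1 + p.2 <= s].

(** Replacing the second entry [j] by [s - j] turns these pairs into the sorted ones. *)
Lemma card_gaps : 2 * #|gaps| = s.+1 * s.+2.
Proof.
have -> : #|gaps| = size (sorted_pairs s.+1).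
  rewrite /sorted_pairs -cardE.
  pose f (p : 'I_s.+1 * 'I_s.+1) := (p.1, rev_ord p.2).
  have f_inj : injective f.
    move=> [i j] [i' j'] E; have /= -> := congr1 fst E.
    by have /= /rev_ord_inj -> := congr1 snd E.
  rewrite -(card_imset _ f_inj); apply: eq_card => -[i j].
  apply/idP/imsetP => [|[[i' j'] + [-> ->]]].
    rewrite inE /= => ij; exists (i, rev_ord j); last by rewrite /f /= rev_ordK.
    by rewrite !inE /=; have := ltn_ord j; lia.
  by rewrite !inE /= => ij; have := ltn_ord j'; lia.
by rewrite size_sorted_pairs; have := bin2_double s.+2; lia.
Qed.

Lemma card_mis_triples : 3 * #|mis| <= n * #|gaps|.
Proof.
have -> : #|gaps| = #|{: {p | p \in gaps}}| by rewrite card_sig.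
rewrite mulnC -sum_nat_const -(eq_bigr _ mis_triple_card).
apply: (@sum_card_max_independent _ _ _ (fun t : 'I_n * {p | p \in gaps} =>
  [set t.1; vshift t.1 (s.+1 + (val t.2).1);
            vshift t.1 (s.*2.+2 + (val t.2).1 + (val t.2).2)])).
move=> A a mA aA; have [p1 [p2 [p12 ->]]] := mis_tripleP nE mA aA.
have p1s : p1 < s.+1 by lia.
have p2s : p2 < s.+1 by lia.
have pg : (Ordinal p1s, Ordinal p2s) \in gaps by rewrite inE.
by exists (exist (fun p => p \in gaps) _ pg).
Qed.

Local Notation code :=
  ('I_n * (('I_s.+1 * 'I_s.+1) * ('I_s.+1 * 'I_s.+1) * 'I_3))%type.

(* Triples with gaps [p] from [t.1] and gaps [u] from [t.1 + triple_shift t]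
   interleave when the shift is between [triple_low t] and [triple_high t]. *)
Definition triple_low (t : code) : nat :=
  let: (a, (p, u, j)) := t in maxn (p.1 - u.1) (p.1 + p.2 - (u.1 + u.2)).

Definition triple_high (t : code) : nat :=
  let: (a, (p, u, j)) := t in
  minn (s.+1 + p.1) (minn (s.+1 + p.1 + p.2 - u.1) (s.*2.+1 - u.1 - u.2)).

Definition triple_shift (t : code) : nat := triple_low t + t.2.2.

Definition interleaved : pred code := fun t =>
  let: (a, (p, u, j)) := t in
  [&& p.1 + p.2 <= s, u.1 + u.2 <= s & triple_shift t <= triple_high t].

Definition triple_seq (t : code) : seq nat :=
  let: (a, (p, u, j)) := t in
  let x := a + triple_shift t in
  [:: a : nat; x; a + (s.+1 + p.1); x + (s.+1 + u.1);
      a + (s.*2.+2 + p.1 + p.2); x + (s.*2.+2 + u.1 + u.2)].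

(* For given gaps at most one of the three shifts is too large, and this
   happens for three pairs of gaps only. *)
Lemma card_interleaved : n * (3 * (#|gaps| * #|gaps|) - 3) <= #|interleaved|.
Proof.
pose o := (ord0 : 'I_s.+1); pose m := (ord_max : 'I_s.+1); pose j2 := (ord_max : 'I_3).
pose E := setX (setX gaps gaps) [set: 'I_3].
pose X := [set ((o, m), (o, o), j2); ((o, o), (m, o), j2); ((m, o), (o, m), j2)].
have EX : 3 * (#|gaps| * #|gaps|) - 3 <= #|E :\: X|.
  rewrite cardsD; apply: leq_sub.
    by rewrite /E !cardsX cardsT card_ord mulnC.
  apply: leq_trans (subset_leq_card (subsetIr _ _)) _.
  apply: leq_trans (leq_card_setU _ _) _; rewrite cards1 addn1 ltnS.
  by apply: leq_trans (leq_card_setU _ _) _; rewrite !cards1.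
apply: leq_trans (leq_mul (leqnn n) EX) _.
rewrite -[n in n * _](card_ord n) -cardsT -cardsX.
apply/subset_leq_card/subsetP => -[a [[[p1 p2] [u1 u2]] j]].
rewrite !inE /= andbT => /andP[notX /andP[pg ug]].
rewrite /in_mem /= pg ug /=; rewrite leqNgt; apply: contraNN notX.
rewrite /triple_shift /triple_high /triple_low /= => bad.
have jl := ltn_ord j.
have [] := interleaved_exception s_gt0 pg ug jl bad.
all: case=> h1 h2 h3 h4 h5; rewrite !xpair_eqE -!(inj_eq val_inj) /=.
all: by rewrite h1 h2 h3 h4 h5 !eqxx ?orbT.
Qed.

(** Six entries alternating between two triples mean at most six codes for each sum. *)
Lemma double_sums_triples :
  n * (3 * (#|gaps| * #|gaps|) - 3) <= 2 * 3 * size sums.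
Proof.
apply: leq_trans card_interleaved _.
pose c t i := nth 0 (triple_seq t) i.
pose S t := [set vtx (c t 0); vtx (c t 2); vtx (c t 4)].
pose S' t := [set vtx (c t 1); vtx (c t 3); vtx (c t 5)].
(* Interleaving is restated once as linear inequalities, free of minima, maxima and truncated
   subtraction. *)
have bounds a p1 p2 u1 u2 j (t := (a, ((p1, p2), (u1, u2), j)) : code) :
    t \in interleaved -> [/\ p1 + p2 <= s, u1 + u2 <= s & [/\ a < n,
      p1 <= triple_shift t + u1, p1 + p2 <= triple_shift t + u1 + u2,
      triple_shift t <= s.+1 + p1 & triple_shift t + u1 <= s.+1 + p1 + p2 /\
      triple_shift t + u1 + u2 <= s.*2.+1]].
  rewrite {1}/in_mem /= => /and3P[-> -> le]; split=> //; move: le.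
  rewrite /triple_shift /triple_high /triple_low /=; have := ltn_ord a.
  have := ltn_ord u1; have := ltn_ord u2; have := ltn_ord j.
  by clear - s_gt0 => *; split; lia.
apply: (@card_unrolled_le n 6 _ _ _ triple_seq
  (fun t => (cover_mon (S t) + cover_mon (S' t))%MM)) => //.
- move=> [a [[[p1 p2] [u1 u2]] j]] /bounds /=; set x := triple_shift _.
  move=> [ps us [an h1 h2 h3 [h4 h5]]]; split=> //.
  by rewrite /unrolled /triple_seq /= -/x; clear - ps us an h1 h2 h3 h4 h5 nE; lia.
- move=> [a [[[p1 p2] [u1 u2]] j]] [a' [[[p1' p2'] [u1' u2']] j']] _ _.
  rewrite /triple_seq; set x := triple_shift _; set x' := triple_shift _ => /=.
  move=> [E1 E2 E3 E4 E5 E6].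
  have Ea : a = a' by apply: val_inj.
  have Ep1 : p1 = p1' by apply: val_inj => /=; lia.
  have Ep2 : p2 = p2' by apply: val_inj => /=; lia.
  have Eu1 : u1 = u1' by apply: val_inj => /=; lia.
  have Eu2 : u2 = u2' by apply: val_inj => /=; lia.
  have : x = x' by lia.
  rewrite /x /x' /triple_shift /= Ea Ep1 Ep2 Eu1 Eu2 => /addnI Ej.
  by congr (_, (_, _, _)); exact: val_inj.
- move=> [a [[[p1 p2] [u1 u2]] j]] /bounds /=; set x := triple_shift _.
  move=> [ps us [an h1 h2 h3 [h4 h5]]].
  rewrite /S /S' /c /triple_seq /= -/x.
  apply: mem_double_sums; apply: mis_vtx3;
    clear - ps us an h1 h2 h3 h4 h5 nE; lia.
have count_seq t v : t \in interleaved ->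
    count_mem (val v) [seq i %% n | i <- triple_seq t] = (v \in S t) + (v \in S' t).
  move: t => [a [[[p1 p2] [u1 u2]] j]] /bounds /=; set x := triple_shift _.
  move=> [ps us [an h1 h2 h3 [h4 h5]]].
  rewrite /S /S' /c /triple_seq /= -/x !mem_vtx3;
    by clear - ps us an h1 h2 h3 h4 h5 nE; lia.
by move=> t u tI uI; apply: (cover_pair_perm n_gt0) => v; exact: count_seq.
Qed.

Lemma not_Freiman_triples : 1 < s -> ~ Freiman (cover_ideal k (circulant n s)).
Proof.
move=> s2 F; have n3 : 3 < n by lia.
have [l ln E] := Freiman_cover_count mis_triple_card n3 F.
have M2 := card_gaps; have M3 : 3 <= #|gaps| by nia.
have := Freiman_equality_bound n_gt0 M3 ln card_mis_triples double_sums_triples E.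
rewrite nE; clear - M2 s2; set M := #|_| in M2 *.
(* For [s = 2] the bound would say 135 <= 132; from [s = 3] on, [8 * s + 6 <= 3 * M] contradicts
   it. *)
have [s2E|s3] : s = 2 \/ 3 <= s by lia.
  have -> : M = 6 by move: M2; rewrite s2E; lia.
  by rewrite s2E.
have : 8 * s + 6 <= 3 * M by nia.
by clear - M2 s3; nia.
Qed.

End Triples.

End Circulant.

Lemma isomorphic_card (n m : nat) (G : sgraph 'I_n) (H : sgraph 'I_m) :
  isomorphic G H -> n = m.
Proof. by move=> [f [/bij_eq_card]]; rewrite !card_ord. Qed.

Theorem theorem5p4 (k : fieldType) (n s : nat)
    (n_gt0 : (0 < n)%N) (hs : (1 <= s <= n %/ 2)%N) :
  Freiman (cover_ideal k (circulant n s)) <->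
  ((n%:R - 4%:R) / 2%:R < s%:R :> rat) \/
  isomorphic (circulant n s) (cycle_graph 5) \/
  isomorphic (circulant n s) (cycle_graph 7).
Proof.
have s_gt0 : (0 < s)%N by lia.
have s_le : (s.*2 <= n)%N by lia.
have -> : ((n%:R - 4%:R) / 2%:R < s%:R :> rat) = (n < s.*2 + 4)%N.
  by rewrite ltr_pdivrMr ?ltr0n // ltrBlDr -natrM -natrD ltr_nat muln2.
split=> [F|].
  case: (ltnP n (s.*2 + 4)) => n_ge; [by left|right; right].
  have [_ qF _] := F.
  case: (leqP n (3 * s + 2)) => n1.
    by case: (@not_Freiman_pairs k n s) => //; lia.
  case: (leqP n (4 * s + 2)) => n2.
    by case: (@not_quasi_equigenerated_between k n s) => //; lia.
  case: (leqP (4 * s + 4) n) => n3.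
    by case: (@not_quasi_equigenerated_large k n s) => //; lia.
  have nE : n = (4 * s + 3)%N by lia.
  case: (ltnP 1 s) => s1; first by case: (@not_Freiman_triples k n s).
  have s1E : s = 1%N by lia.
  rewrite s1E in nE *; rewrite nE.
  by exists id; split=> //; exists id.
have Fr : (n < s.*2 + 4)%N -> Freiman (cover_ideal k (circulant n s)).
  move=> n_lt; case: (leqP n s.*2.+1) => n1; first exact: Freiman_complete.
  case: (leqP n s.*2.+2) => n2; first by apply: Freiman_cocktail => //; lia.
  by apply: Freiman_odd_cycle_complement => //; lia.
case=> [//|[/isomorphic_card n5|/isomorphic_card n7]]; first by apply: Fr; lia.
case: (ltnP 1 s) => s1; first by apply: Fr; lia.
by apply: Freiman_heptagon => //; lia.
Qed.
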